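(* Let $L>0$, let $\{\boldsymbol t^0,\boldsymbol d_1^0,\boldsymbol d_2^0\}$ be an orthonormal basis of $\mathbb R^3$, and let $u_i\colon[0,L]\to\mathbb R$, $i=1,2$, with $u_i\in L^2(0,L)$, be such that the curve $\boldsymbol x$ uniquely determined by the system $$\boldsymbol t'=u_2\,\boldsymbol d_1-u_1\boldsymbol d_2,\qquad \boldsymbol d_1'=-u_2\,\boldsymbol t,\qquad \boldsymbol d_2'=u_1\,\boldsymbol t,$$ with initial conditions $\boldsymbol t(0)=\boldsymbol t^0$, $\boldsymbol d_1(0)=\boldsymbol d_1^0$, $\boldsymbol d_2(0)=\boldsymbol d_2^0$, is of class $C^3((0,L);\mathbb R^3)$. Assume that $|\boldsymbol t'|=|\boldsymbol x''|\neq 0$ everywhere. Let $\kappa,\tau$ be the curvature and the torsion of $\boldsymbol x$. Then there exists $\vartheta\in C^1([0,L])$ such that $$\vartheta'=\tau,\qquad u_1=\kappa\sin\vartheta,\qquad u_2=\kappa\cos\vartheta.$$ In particular, $\sqrt{u_1^2+u_2^2}=\kappa$.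
   Context: For $u_1,u_2\in L^2(0,L)$ the system with the given initial conditions has a unique solution $(\boldsymbol t,\boldsymbol d_1,\boldsymbol d_2)\in(W^{1,2}((0,L);\mathbb R^3))^3$, and it is an orthonormal frame. The associated curve is reconstructed by $\boldsymbol x(s)=\boldsymbol t^0+\int_0^s\boldsymbol t(r)\,dr$, so $\boldsymbol x$ is parametrized by arc-length and $\boldsymbol x'=\boldsymbol t$. Convention for curvature and torsion: for a $C^3$ curve $\boldsymbol x$ parametrized by arc-length with $\boldsymbol t=\boldsymbol x'$ and $|\boldsymbol t'|\neq0$ everywhere, the (positive) curvature is $\kappa=|\boldsymbol t'|$, the principal normal is $\boldsymbol n=\boldsymbol t'/|\boldsymbol t'|$, the binormal is $\boldsymbol b=\boldsymbol t\times\boldsymbol n$, and the torsion $\tau$ is the coefficient in $\boldsymbol b'=\tau\boldsymbol n$. The Serret-Frenet system then reads $\boldsymbol t'=\kappa\boldsymbol n$, $\boldsymbol n'=-\kappa\boldsymbol t-\tau\boldsymbol b$, $\boldsymbol b'=\tau\boldsymbol n$.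
   Formalization: The initial basis is taken positively oriented (otherwise ϑ'=−τ); ϑ is C^1 on (0,L), and C^1([0,L]) only if x is C^3 on [0,L] with x''≠0 also at the end points (otherwise false, e.g. ϑ=√s); the identities for u_1, u_2 hold almost everywhere. *)

(* Defs.v *)
From HB Require Import structures.
From mathcomp Require Import all_boot all_order all_algebra.
From mathcomp Require Import all_classical all_reals all_analysis.

Set Implicit Arguments.
Unset Strict Implicit.
Unset Printing Implicit Defensive.

Import Order.TTheory GRing.Theory Num.Theory.
Import numFieldNormedType.Exports.

Local Open Scope ring_scope.
Local Open Scope classical_set_scope.

Definition dot (R : realType) (u v : 'rV[R]_3) : R := \sum_(i < 3) u 0 i * v 0 i.

(* The library norm `|u| on 'rV[R]_3 is the sup norm, hence this definition. *)
Definition enorm (R : realType) (u : 'rV[R]_3) : R := Num.sqrt (dot u u).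

(* (u x v)_i = u_{i+1} v_{i+2} - u_{i+2} v_{i+1}, with indices in Z/3Z. *)
Definition cross (R : realType) (u v : 'rV[R]_3) : 'rV[R]_3 :=
  \row_(i < 3) (u 0 (i + 1) * v 0 (i + 1 + 1) - u 0 (i + 1 + 1) * v 0 (i + 1)).

Definition orthonormal3 (R : realType) (a b c : 'rV[R]_3) : Prop :=
  [/\ dot a a = 1, dot b b = 1 & dot c c = 1] /\
  [/\ dot a b = 0, dot a c = 0 & dot b c = 0].

(* Continuity of the lower-order derivatives follows from derivability. *)
Definition Ck (R : realType) (V : normedModType R) (k : nat) (A : set R)
    (f : R -> V) : Prop :=
  forall s, A s ->
    (forall j, (j < k)%N -> derivable (derive1n j f) s 1) /\
    {for s, continuous (derive1n k f)}.

(* C^k([a, b]): the derivatives in `]a, b[ up to order k extend continuously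
   to `[a, b]; for the order 0, f itself is the extension. *)
Definition Ck_closed (R : realType) (V : normedModType R) (k : nat) (a b : R)
    (f : R -> V) : Prop :=
  [/\ Ck k `]a, b[ f,
      {within `[a, b], continuous f} &
      forall j, (0 < j <= k)%N ->
        cvg (derive1n j f s @[s --> a^'+]) /\ cvg (derive1n j f s @[s --> b^'-])].

Definition L2 (R : realType) (L : R) (f : R -> R) : Prop :=
  f \_ `]0, L[ \in Lfun (@lebesgue_measure R) 2%:E.

(* C^1_c(]0, L[); replacing it by C^oo_c gives the same weak derivatives,
   by mollification. *)
Definition test_function (R : realType) (L : R) (phi : R -> R) : Prop :=
  Ck 1 setT phi /\ closure [set s | phi s != 0] `<=` `]0, L[.

Definition weak_derivative (R : realType) (L : R) (f g : R -> R) : Prop :=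
  forall phi, test_function L phi ->
    \int[lebesgue_measure]_(s in `]0, L[) (f s * derive1 phi s) =
    - \int[lebesgue_measure]_(s in `]0, L[) (g s * phi s).

Definition W12 (R : realType) (L : R) (f : R -> R) : Prop :=
  L2 L f /\ exists2 g, L2 L g & weak_derivative L f g.

(* Vector-valued versions, componentwise. An element of W^{1,2} is identified
   with its continuous representative on [0, L], which gives a meaning to its
   value at 0. *)
Definition W12v (R : realType) (L : R) (f : R -> 'rV[R]_3) : Prop :=
  {within `[0, L], continuous f} /\ forall i, W12 L (fun s => f s 0 i).

Definition weak_derivativev (R : realType) (L : R) (f g : R -> 'rV[R]_3) : Prop :=
  forall i, weak_derivative L (fun s => f s 0 i) (fun s => g s 0 i).

Definition frame_solution (R : realType) (L : R) (u1 u2 : R -> R)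
    (t0 d10 d20 : 'rV[R]_3) (t d1 d2 : R -> 'rV[R]_3) : Prop :=
  [/\ [/\ W12v L t, W12v L d1 & W12v L d2],
      weak_derivativev L t (fun s => u2 s *: d1 s - u1 s *: d2 s),
      weak_derivativev L d1 (fun s => - (u2 s *: t s)),
      weak_derivativev L d2 (fun s => u1 s *: t s) &
      [/\ t 0 = t0, d1 0 = d10 & d2 0 = d20]].

Definition curve (R : realType) (t0 : 'rV[R]_3) (t : R -> 'rV[R]_3) (s : R) :
    'rV[R]_3 :=
  t0 + \row_(i < 3) \int[lebesgue_measure]_(r in `[0, s]) t r 0 i.

Definition tangent (R : realType) (x : R -> 'rV[R]_3) : R -> 'rV[R]_3 := derive1 x.

Definition curvature (R : realType) (x : R -> 'rV[R]_3) (s : R) : R :=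
  enorm (derive1 (tangent x) s).

Definition normal (R : realType) (x : R -> 'rV[R]_3) (s : R) : 'rV[R]_3 :=
  (curvature x s)^-1 *: derive1 (tangent x) s.

Definition binormal (R : realType) (x : R -> 'rV[R]_3) (s : R) : 'rV[R]_3 :=
  cross (tangent x s) (normal x s).

(* The coefficient tau in b' = tau n; it is unique as soon as n <> 0. *)
Definition torsion (R : realType) (x : R -> 'rV[R]_3) (s : R) : R :=
  xget 0 [set tau | derive1 (binormal x) s = tau *: normal x s].

(* Main.v *)
Require Import Defs.
From mathcomp Require Import all_boot all_order all_algebra.
From mathcomp Require Import all_classical all_reals all_analysis.
From mathcomp Require Import measurable_realfun ring lra.

Set Implicit Arguments.
Unset Strict Implicit.
Unset Printing Implicit Defensive.

Import Order.TTheory GRing.Theory Num.Theory.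
Import numFieldNormedType.Exports.

Local Open Scope ring_scope.
Local Open Scope classical_set_scope.

(** The weak system means that, on [0, L], the frame consists of primitives of
    integrable functions: test against smooth approximations of the indicator
    of ]a, b] and let them tend to it. Products of primitives are primitives,
    so if A is the matrix with rows t, d1, d2, then A' = U A with U
    antisymmetric gives that A^T A is constant; the frame stays orthonormal,
    and positively oriented by the intermediate value theorem.

    Since t is of class C^2, Lebesgue differentiation gives
    x'' = u2 d1 - u1 d2 almost everywhere, hence u1 and u2 agree almost
    everywhere with the continuous functions v1 = - x'' . d2 and
    v2 = x'' . d1, and then d1' = - v2 t and d2' = v1 t in the classical sense.
    The point (p, q) = (v2, v1) / |x''| moves on the unit circle with C^1
    coordinates; its angle theta is a primitive of p q' - q p'. The binormal is
    b = q d1 + p d2, so b' = q' d1 + p' d2 = theta' (p d1 - q d2) = theta' n,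
    that is, theta' is the torsion. The formula
    theta' = (v2 v1' - v1 v2') / |x''|^2 only involves x'', x''', d1 and d2,
    which yields the limits at the endpoints. *)

(** * Primitives of integrable functions *)

Section integrable_EFin.
Context d (T : measurableType d) (R : realType) (mu : {measure set T -> \bar R}).
Variables (D : set T) (mD : measurable D).
Implicit Types f g : T -> R.

Lemma integrable_EFinD f g : mu.-integrable D (EFin \o f) ->
  mu.-integrable D (EFin \o g) -> mu.-integrable D (EFin \o (fun s => f s + g s)).
Proof. by move=> intf intg; exact: (integrableD mD intf intg). Qed.

Lemma integrable_EFinB f g : mu.-integrable D (EFin \o f) ->
  mu.-integrable D (EFin \o g) -> mu.-integrable D (EFin \o (fun s => f s - g s)).
Proof. by move=> intf intg; exact: (integrableB mD intf intg). Qed.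

Lemma integrable_EFinZl k f : mu.-integrable D (EFin \o f) ->
  mu.-integrable D (EFin \o (fun s => k * f s)).
Proof. by move=> intf; exact: (integrableZl mD k intf). Qed.

Lemma integrable_EFinZr k f : mu.-integrable D (EFin \o f) ->
  mu.-integrable D (EFin \o (fun s => f s * k)).
Proof. by move=> intf; exact: (integrableZr mD k intf). Qed.

End integrable_EFin.

Section primitive.
Context {R : realType}.
Notation mu := (@lebesgue_measure R).
Implicit Types F G f g : R -> R.

(** Absolute continuity on the whole line with density [f]. Integrability on all of R, obtained
    later by extending densities by zero outside ]0, L[, makes [F] bounded and uniformly continuous,
    so that products of primitives are primitives without endpoint conditions. *)
Definition primitive F f :=
  mu.-integrable setT (EFin \o f) /\
  forall a b : R, a <= b -> F b - F a = \int[mu]_(x in `]a, b]) f x.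

Lemma primitive_Rintegral f (c : R) : mu.-integrable setT (EFin \o f) ->
  primitive (fun s => c + \int[mu]_(x in `]-oo, s]) f x) f.
Proof.
move=> intf; split=> // a b ab.
rewrite opprD addrACA subrr add0r Rintegral_itvB//.
by apply: (integrableS _ _ _ intf).
Qed.

Lemma le_normr_Rintegral_itv f (a b a' b' : R) : mu.-integrable setT (EFin \o f) ->
  `]a, b] `<=` `]a', b'] ->
  `|\int[mu]_(x in `]a, b]) f x| <= \int[mu]_(x in `]a', b']) `|f x|.
Proof.
move=> intf sub; have intn := integrable_norm intf.
apply: (le_trans (le_normr_Rintegral _ _)) => //.
  exact: (integrableS _ _ _ intf).
rewrite fine_le//.
- by apply: integrable_fin_num => //; exact: (integrableS _ _ _ intn).
- by apply: integrable_fin_num => //; exact: (integrableS _ _ _ intn).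
- apply: ge0_subset_integral => //.
  by apply: measurable_int; exact: (integrableS _ _ _ intn).
Qed.

(** Absolute continuity of the integral. The modulus is uniform because the subdivision behind
    [primitiveM] needs one [d] for all pieces. *)
Lemma primitive_unif_cont F f : primitive F f -> forall e : R, 0 < e ->
  exists2 d, 0 < d & forall a b : R, `|b - a| < d -> `|F b - F a| < e.
Proof.
move=> [intf Ff] e e0; have [d [d0 H]] := integral_normr_continuous intf e0.
exists d => //; have key (a b : R) : a <= b -> b - a < d -> `|F b - F a| < e.
  move=> ab bad; rewrite Ff//.
  have mab : (mu `]a, b] < d%:E)%E.
    rewrite lebesgue_measure_itv/= lte_fin.
    by case: ifPn => _; rewrite ?lte_fin // -EFinD lte_fin.
  have /le_lt_trans := le_normr_Rintegral_itv intf (@subset_refl _ `]a, b]).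
  by apply; exact: H.
move=> a b; have [ab|/ltW ba] := leP a b.
  by rewrite ger0_norm ?subr_ge0//; exact: key.
by rewrite distrC (distrC (F b)) ger0_norm ?subr_ge0//; exact: key.
Qed.

Lemma primitive_continuous F f : primitive F f -> continuous F.
Proof.
move=> pF x; apply/cvgrPdist_lt => e e0.
have [d d0 Hd] := primitive_unif_cont pF e0.
by apply/nbhs_ballP; exists d => //= y; exact: Hd.
Qed.

Lemma primitive_bounded F f : primitive F f -> [bounded F x | x in setT].
Proof.
move=> [intf Ff]; exists (`|F 0| + \int[mu]_x `|f x|); split; first exact: num_real.
have intn := integrable_norm intf.
have key (a b : R) : a <= b -> `|F b - F a| <= \int[mu]_x `|f x|.
  move=> ab; rewrite Ff//; apply: (le_trans (le_normr_Rintegral_itv intf _)).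
    by move=> ?; exact.
  rewrite fine_le//.
  - by apply: integrable_fin_num => //; exact: (integrableS _ _ _ intn).
  - exact: integrable_fin_num.
  - apply: ge0_subset_integral => //; exact: measurable_int intn.
move=> M ltM x _; apply: (le_trans _ (ltW ltM)).
rewrite -[F x](subrK (F 0)) addrC (le_trans (ler_normD _ _))// lerD2l.
have [x0|/ltW x0] := leP 0 x; first exact: key.
by rewrite distrC; exact: key.
Qed.

Lemma primitive_integrableM F f g : primitive F f ->
  mu.-integrable setT (EFin \o g) -> mu.-integrable setT (EFin \o (F \* g)).
Proof.
move=> pF intg.
have -> : EFin \o (F \* g) = ((EFin \o F) \* (EFin \o g))%E by [].
apply: integrableMr => //; last exact: primitive_bounded pF.
apply: continuous_measurable_fun; exact: primitive_continuous pF.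
Qed.

(** Cut [a, b] into pieces shorter than [d]: the errors telescope to e (N b - N a), where [N] stays
    fixed while [e] tends to 0. *)
Lemma increment_small_cst (H N : R -> R) :
  (forall e, 0 < e -> exists2 d, 0 < d &
    forall a b : R, a <= b -> b - a < d -> `|H b - H a| <= e * (N b - N a)) ->
  forall a b : R, H a = H b.
Proof.
move=> HN; suff key (a b : R) : a <= b -> H b = H a.
  move=> a b; have [ab|/ltW ba] := leP a b; first by rewrite (key a b).
  by rewrite (key b a).
move=> ab.
have all_e (e : R) : 0 < e -> `|H b - H a| <= e * (N b - N a).
  move=> e0; have [d d0 Hd] := HN e e0.
  have d2 : 0 < d / 2 by rewrite divr_gt0.
  (* [n] bounds the number of steps of length d / 2, which is strictly less than [d] as [HN]
     requires. *)
  have ind n : forall a' b', a' <= b' -> b' - a' <= n%:R * (d / 2) ->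
      `|H b' - H a'| <= e * (N b' - N a').
    elim: n => [|n IH] a' b' a'b'.
      rewrite mul0r subr_le0 => b'a'; apply: Hd => //.
      by rewrite (le_lt_trans _ d0)// subr_le0.
    have [small|large] := ltP (b' - a') d; first by move=> _; exact: Hd.
    rewrite -natr1 mulrDl mul1r => len.
    have h1 : `|H (a' + d / 2) - H a'| <= e * (N (a' + d / 2) - N a').
      by apply: Hd; lra.
    have h2 : `|H b' - H (a' + d / 2)| <= e * (N b' - N (a' + d / 2)).
      by apply: IH; lra.
    rewrite -(subrKA (H (a' + d / 2))) (le_trans (ler_normD _ _))//.
    by rewrite (le_trans (lerD h2 h1))// -mulrDr subrKA.
  apply: (ind (Num.bound ((b - a) / (d / 2)))) => //.
  by rewrite -ler_pdivrMr// ltW// archi_boundP// divr_ge0// ?subr_ge0// ltW.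
have N0 : 0 <= N b - N a.
  by have := all_e 1 ltr01; rewrite mul1r; exact: le_trans.
apply/eqP; rewrite -subr_eq0 -normr_le0; apply/ler_addgt0Pr => e e0.
(* Adding 1 keeps the divisor positive when N a = N b. *)
rewrite add0r; have k0 : 0 < N b - N a + 1 by lra.
apply: (le_trans (all_e (e / (N b - N a + 1)) _)); first by rewrite divr_gt0.
by rewrite mulrAC ler_pdivrMr// ler_pM2l//; lra.
Qed.

(** Integration by parts through a direct estimate: F G minus an antiderivative [S] of the expected
    density is constant by [increment_small_cst]. *)
Lemma primitiveM F f G g : primitive F f -> primitive G g ->
  primitive (fun s => F s * G s) (fun s => G s * f s + F s * g s).
Proof.
move=> pF pG; have [[intf Ff] [intg Gg]] := (pF, pG).
have intS : mu.-integrable setT (EFin \o (fun s => G s * f s + F s * g s)).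
  apply: integrable_EFinD => //.
    exact: primitive_integrableM pG intf.
  exact: primitive_integrableM pF intg.
split=> // a0 b0 a0b0.
have intN : mu.-integrable setT (EFin \o (fun s => `|f s| + `|g s|)).
  by apply: integrable_EFinD => //; exact: integrable_norm.
pose S (s : R) := 0 + \int[mu]_(x in `]-oo, s]) (G x * f x + F x * g x).
pose N (s : R) := 0 + \int[mu]_(x in `]-oo, s]) (`|f x| + `|g x|).
have [_ PS] : primitive S _ := primitive_Rintegral 0 intS.
have [_ PN] : primitive N _ := primitive_Rintegral 0 intN.
rewrite -PS//; suff /eqP : F a0 * G a0 - S a0 = F b0 * G b0 - S b0.
  by rewrite subr_eq => /eqP ->; ring.
(* When [F] and [G] vary by less than [e], the integral of [G f + F g] misses the
   increment of [F G] by at most [e] times the integral of [|f| + |g|]. *)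
apply: (@increment_small_cst (fun s => F s * G s - S s) N) => e e0.
have [d1 d10 H1] := primitive_unif_cont pF e0.
have [d2 d20 H2] := primitive_unif_cont pG e0.
exists (Num.min d1 d2); first by rewrite lt_min d10.
move=> a b ab; rewrite lt_min => /andP[bad1 bad2].
(* Freezing [G] at [b] and [F] at [a] writes every increment as an integral over ]a, b], so that the
   integrands can be compared pointwise. *)
have -> : F b * G b - S b - (F a * G a - S a) =
    (F b - F a) * G b + F a * (G b - G a) - (S b - S a) by ring.
have mI : measurable (`]a, b] : set (measurableTypeR R)) by [].
have sub h : mu.-integrable setT (EFin \o h) -> mu.-integrable `]a, b] (EFin \o h).
  by move=> ih; exact: (integrableS _ _ _ ih).
rewrite PS// PN// Ff// Gg// -RintegralZr//; last exact: sub.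
rewrite -RintegralZl//; last exact: sub.
have intfG := integrable_EFinZr mI (G b) (sub _ intf).
have intFg := integrable_EFinZl mI (F a) (sub _ intg).
have intD := integrable_EFinD mI intfG intFg.
have intE := integrable_EFinB mI intD (sub _ intS).
rewrite -RintegralD// -RintegralB//; last exact: sub.
apply: (le_trans (le_normr_Rintegral _ _)) => //.
rewrite -RintegralZl//; last exact: sub.
apply: le_Rintegral => //.
- exact: integrable_norm.
- exact/integrable_EFinZl/sub.
move=> x; rewrite /= in_itv/= => /andP[ax xb].
have -> : f x * G b + F a * g x - (G x * f x + F x * g x) =
  (G b - G x) * f x + (F a - F x) * g x by ring.
rewrite mulrDr (le_trans (ler_normD _ _))// !normrM lerD// ler_wpM2r//.
  by apply/ltW/H2; rewrite ger0_norm; lra.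
by apply/ltW/H1; rewrite ler0_norm; lra.
Qed.

End primitive.

(** * From the weak to the integral form *)

Section smooth_step.
Context {R : realType}.
Implicit Types x a s : R.

(** Squaring the positive part gives a C^1 function that vanishes on a half-line, the building block
    of the test functions. *)
Definition sqpos x : R := Num.max x 0 ^+ 2.

Lemma max0_continuous : continuous (fun x : R => Num.max x 0).
Proof.
have -> : (fun x : R => Num.max x 0) = fun x => (x + `|x|) * 2^-1.
  by apply/funext => x; rewrite maxr_absE addr0 subr0.
move=> x; apply: cvgM; last exact: cvg_cst.
by apply: cvgD; [exact: cvg_id|exact: norm_continuous].
Qed.

Lemma is_derive_sqpos x : is_derive x 1 sqpos (2 * Num.max x 0).
Proof.
have [x0|x0|->] := ltgtP x 0.
- rewrite mulr0; apply: (@near_eq_is_derive _ _ _ (cst 0)).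
  near=> y; rewrite /sqpos max_r ?expr0n//=.
  by apply: ltW; near: y; exact: lt_nbhsl.
- apply: (@near_eq_is_derive _ _ _ ((idfun : R -> R) ^+ 2)).
    near=> y; rewrite /sqpos max_l//.
    by apply: ltW; near: y; exact: lt_nbhsr.
  by apply: is_derive_eq; rewrite expr1 [LHS]mulr1.
(* At 0 the slope function is explicit: max(z, 0)^2 = max(z, 0) z. *)
- apply/is_derive1_caratheodory; exists (fun z => Num.max z 0); split.
  + move=> z; rewrite /sqpos maxxx expr0n/= !subr0.
    by have [z0|z0] := leP z 0; rewrite ?mul0r ?expr0n ?expr2.
  + exact: max0_continuous.
  + by rewrite maxxx mulr0.
Unshelve. all: by end_near. Qed.

(* [ramp] climbs from [0] to [1] on the unit interval; as a combination of
   squares of positive parts it is of class C^1, with derivative [hat]. *)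
Definition ramp x : R := 2 * sqpos x - 4 * sqpos (x - 2^-1) + 2 * sqpos (x - 1).

(** The tent of height 2 over the unit interval, of integral 1. *)
Definition hat x : R :=
  4 * Num.max x 0 - 8 * Num.max (x - 2^-1) 0 + 4 * Num.max (x - 1) 0.

Lemma max0E x : (Num.max x 0 = x /\ 0 <= x) \/ (Num.max x 0 = 0 /\ x <= 0).
Proof. by have [x0|x0] := leP x 0; [right|left; split=> //; exact: ltW]. Qed.

Lemma ramp_le0 x : x <= 0 -> ramp x = 0.
Proof.
move=> x0; rewrite /ramp /sqpos !max_r; [ring|lra|lra|lra].
Qed.

Lemma ramp_ge1 x : 1 <= x -> ramp x = 1.
Proof.
move=> x1; rewrite /ramp /sqpos !max_l; [by field|lra|lra|lra].
Qed.

Lemma ramp_ge0_le1 x : 0 <= ramp x <= 1.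
Proof.
have [x0|/ltW x0] := leP x 0; first by rewrite ramp_le0// lexx ler01.
have [x1|/ltW x1] := leP 1 x; first by rewrite ramp_ge1// lexx ler01.
rewrite /ramp /sqpos (max_l x0) (@max_r _ _ (x - 1)); last lra.
by have [[->]|[->]] := max0E (x - 2^-1) => xh; apply/andP; split; nra.
Qed.

Lemma hat_ge0 x : 0 <= hat x.
Proof.
rewrite /hat.
by have [[->]|[->]] := max0E x; have [[->]|[->]] := max0E (x - 2^-1);
  have [[->]|[->]] := max0E (x - 1); lra.
Qed.

Lemma hat_le0 x : x <= 0 -> hat x = 0.
Proof. by move=> x0; rewrite /hat !max_r; lra. Qed.

Lemma hat_ge1 x : 1 <= x -> hat x = 0.
Proof. by move=> x0; rewrite /hat !max_l; lra. Qed.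

Lemma hat_continuous : continuous hat.
Proof.
have c k : continuous (fun x => Num.max (x - k) 0).
    move=> x; apply: (@continuous_comp _ _ _ (fun x : R => x - k) (fun x => Num.max x 0)).
    by apply: cvgB; [exact: cvg_id|exact: cvg_cst].
  exact: max0_continuous.
have -> : hat = fun x => 4 * Num.max (x - 0) 0 - 8 * Num.max (x - 2^-1) 0
    + 4 * Num.max (x - 1) 0 by apply/funext => x; rewrite subr0.
move=> x; apply: cvgD; first apply: cvgB;
  by apply: cvgM; [exact: cvg_cst|exact: c].
Qed.

Lemma is_derive_ramp x : is_derive x 1 ramp (hat x).
Proof.
have d k : is_derive x 1 (fun y => sqpos (y - k)) (2 * Num.max (x - k) 0).
  rewrite -[2 * _]mulr1; apply: (@is_derive1_comp _ sqpos (fun y => y - k)).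
    exact: is_derive_sqpos.
  by rewrite -[1 in X in is_derive _ _ _ X]subr0; exact: is_deriveB.
have -> : ramp = (2 \*: (fun y => sqpos (y - 0))) - (4 \*: (fun y => sqpos (y - 2^-1)))
    + (2 \*: (fun y => sqpos (y - 1))).
  by apply/funext => y; rewrite /ramp -{1}[y]subr0.
apply: is_derive_eq; rewrite /hat subr0 /GRing.scale/=; ring.
Qed.

End smooth_step.

(** * Approximate identities and C^1 bumps *)

Section hat_kernel.
Context {R : realType}.
Notation mu := (@lebesgue_measure R).
Implicit Types (f g : R -> R) (a b k L s : R).

Lemma is_derive_ramp_scaled k a s :
  is_derive s 1 (fun r => ramp (k * (r - a))) (k * hat (k * (s - a))).
Proof.
rewrite mulrC; apply: (@is_derive1_comp _ ramp (fun r => k * (r - a))).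
  exact: is_derive_ramp.
have -> : (fun r => k * (r - a)) = k \*: (idfun - cst a : R -> R).
  by apply/funext => r.
by apply: is_derive_eq; rewrite subr0 [LHS]mulr1.
Qed.

Lemma hat_scaled_continuous k a : continuous (fun s => k * hat (k * (s - a))).
Proof.
move=> s; apply: cvgM; first exact: cvg_cst.
apply: (@continuous_comp _ _ _ (fun r => k * (r - a)) hat).
  by apply: cvgM; [exact: cvg_cst|apply: cvgB; [exact: cvg_id|exact: cvg_cst]].
exact: hat_continuous.
Qed.

Lemma within_continuous_itv_oo_integrable f a b :
  {within `[a, b], continuous f} -> mu.-integrable `]a, b[ (EFin \o f).
Proof.
move=> cf; have := continuous_compact_integrable (@segment_compact _ a b) cf.
by apply: integrableS => //; exact: subset_itv_oo_cc.
Qed.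

Lemma Rintegral_itv_oo_cc f a b : mu.-integrable `]a, b[ (EFin \o f) ->
  \int[mu]_(s in `]a, b[) f s = \int[mu]_(s in `[a, b]) f s.
Proof.
move=> intf; rewrite /Rintegral [in RHS]integral_itv_bndoo//.
exact: measurable_int intf.
Qed.

(** The condition 1 <= k (L - a) puts the support [a, a + 1/k] of the kernel inside [0, L], and its
    mass is the full climb of the scaled ramp. *)
Lemma Rintegral_hat_scaled k a L : 0 < k -> 0 < a -> 1 <= k * (L - a) ->
  \int[mu]_(s in `]0, L[) (k * hat (k * (s - a))) = 1.
Proof.
move=> k0 a0 kLa.
have aL : a < L by rewrite -subr_gt0 -(pmulr_rgt0 _ k0) (lt_le_trans ltr01).
have L0 : 0 < L by exact: lt_trans aL.
have cw : {within `[0, L], continuous (fun s => k * hat (k * (s - a)))}.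
  by apply: continuous_subspaceT; exact: hat_scaled_continuous.
rewrite Rintegral_itv_oo_cc; last exact: within_continuous_itv_oo_integrable.
have dr s := is_derive_ramp_scaled k a s.
rewrite /Rintegral (@continuous_FTC2 _ _ (fun r => ramp (k * (r - a))))//.
- rewrite /= ramp_ge1// ramp_le0 ?subr0// sub0r mulrN oppr_le0.
  by rewrite mulr_ge0// ltW.
- have cr : continuous (fun r => ramp (k * (r - a))).
    move=> s; case: (dr s) => ds _.
    by apply/differentiable_continuous; exact/derivable1_diffP.
  split=> [s _||]; first by case: (dr s).
    exact/cvg_at_right_filter/cr.
  exact/cvg_at_left_filter/cr.
- by move=> s _; rewrite derive1E; case: (dr s).
Qed.

(** The kernels form a one-sided approximate identity: they have mass 1 and live on
    [a, a + 1/(n+1)], where [f] is close to [f a]. *)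
Lemma cvg_Rintegral_hat f a L : 0 < a < L -> {within `[0, L], continuous f} ->
  \int[mu]_(s in `]0, L[) (f s * (n.+1%:R * hat (n.+1%:R * (s - a)))) @[n --> \oo]
  --> f a.
Proof.
move=> /andP[a0 aL] cf; have cf_a : {for a, continuous f}.
  have /(continuous_within_itvP _ (lt_trans a0 aL))[+ _ _] := cf.
  by apply; rewrite in_itv/= a0.
apply/cvgrPdist_le => /= e e0.
have /cvgrPdist_le /(_ e e0)/nbhs_ballP[d /= d0 Hd] := cf_a.
near=> n.
have n0 : 0 < n.+1%:R :> R by [].
have nd : n.+1%:R^-1 < d by near: n; exact: near_infty_natSinv_lt (PosNum d0).
have nL : n.+1%:R^-1 < L - a.
  by near: n; apply: (near_infty_natSinv_lt (PosNum _)); rewrite subr_gt0.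
have nL1 : 1 <= n.+1%:R * (L - a).
  by rewrite -ler_pdivrMl// mulr1 ltW.
pose h s := n.+1%:R * hat (n.+1%:R * (s - a)).
have h0 s : 0 <= h s by rewrite mulr_ge0// hat_ge0.
have ch : continuous h by exact: hat_scaled_continuous.
have ih : mu.-integrable `]0, L[ (EFin \o h).
  by apply: within_continuous_itv_oo_integrable; exact: continuous_subspaceT.
have ifh : mu.-integrable `]0, L[ (EFin \o (fun s => f s * h s)).
  apply: within_continuous_itv_oo_integrable => s.
  by apply: cvgM; [exact: cf|exact: (continuous_subspaceT ch)].
have mI : measurable (`]0, L[ : set (measurableTypeR R)) by [].
have iah := integrable_EFinZl mI (f a) ih.
have int_h : \int[mu]_(s in `]0, L[) h s = 1 by exact: Rintegral_hat_scaled.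
(* Since [h] has mass 1, both [f a] and [e] are integrals against [h], and a pointwise comparison
   suffices. *)
rewrite -[f a in X in X <= _]mulr1 -[X in f a * X]int_h -RintegralZl//.
rewrite -RintegralB//; have iB := integrable_EFinB mI iah ifh.
apply: (le_trans (le_normr_Rintegral _ iB)) => //.
have -> : e = \int[mu]_(s in `]0, L[) (e * h s) by rewrite RintegralZl// int_h mulr1.
apply: le_Rintegral => //; first exact: integrable_norm.
  exact: integrable_EFinZl.
move=> s _; rewrite -mulrBl normrM (ger0_norm (h0 s)).
have [sa|as_] := leP s a.
  by rewrite /h hat_le0 ?mulr0// pmulr_rle0// subr_le0.
have [sb|sb] := leP 1 (n.+1%:R * (s - a)); first by rewrite /h hat_ge1 ?mulr0.
apply: ler_wpM2r => //; apply: Hd.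
rewrite /ball/= distrC ger0_norm ?subr_ge0 ?(ltW as_)//.
by apply: lt_trans nd; rewrite -ltr_pdivlMl// mulr1 in sb.
Unshelve. all: by end_near. Qed.

(** Both transitions take place to the right of their endpoint, on [a, a + 1/k] and [b, b + 1/k], so
    the pointwise limit as k grows is exactly the indicator of ]a, b]. *)
Definition smooth_bump k a b s := ramp (k * (s - a)) - ramp (k * (s - b)).

Lemma is_derive_smooth_bump k a b s : is_derive s 1 (smooth_bump k a b)
  (k * hat (k * (s - a)) - k * hat (k * (s - b))).
Proof.
by apply: is_deriveB; exact: is_derive_ramp_scaled.
Qed.

(** The support lies in the closed interval [a, b + 1/k], since past b + 1/k both ramps equal 1 and
    cancel; the strict bound on [k] keeps it inside ]0, L[. *)
Lemma test_function_smooth_bump k a b L : 0 < a -> a <= b -> 0 < k ->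
  1 < k * (L - b) -> test_function L (smooth_bump k a b).
Proof.
move=> a0 ab k0 kLb.
have dE : (smooth_bump k a b)^`() =
    fun s => k * hat (k * (s - a)) - k * hat (k * (s - b)).
  apply/funext => s; rewrite derive1E.
  by case: (is_derive_smooth_bump k a b s).
split=> [s _|].
  split=> [[|//] _|].
    by case: (is_derive_smooth_bump k a b s).
  rewrite /= dE; apply: cvgB; exact: hat_scaled_continuous.
have sub : [set s | smooth_bump k a b s != 0] `<=` `[a, b + k^-1].
  move=> s /=; apply: contraNT; rewrite in_itv/= negb_and -!ltNge.
  rewrite /smooth_bump => /orP[sa|bs].
    by rewrite !ramp_le0 ?subr0// pmulr_rle0// subr_le0; lra.
  have bs1 : 1 <= k * (s - b) by rewrite -ler_pdivrMl// mulr1; lra.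
  rewrite !ramp_ge1 ?subrr//.
  by rewrite (le_trans bs1)// ler_pM2l// lerB.
apply: (@subset_trans _ `[a, b + k^-1]).
  by rewrite closureE; apply: bigcap_inf; split=> //; exact: interval_closed.
move=> s; rewrite /= !in_itv/= => /andP[as_ sb].
rewrite (lt_le_trans a0)//= (le_lt_trans sb)//.
by rewrite -ltrBrDl -(ltr_pM2l k0) divff// gt_eqF.
Qed.

Lemma smooth_bump_bound k a b s : `|smooth_bump k a b s| <= 1.
Proof.
rewrite ler_norml /smooth_bump.
have /andP[? ?] := ramp_ge0_le1 (k * (s - a)).
have /andP[? ?] := ramp_ge0_le1 (k * (s - b)).
by apply/andP; split; lra.
Qed.

Lemma cvg_ramp a s : ramp (n.+1%:R * (s - a)) @[n --> \oo] --> ((a < s)%R%:R : R).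
Proof.
have [as_|sa] := ltP a s; last first.
  apply: cvg_near_cst; apply: nearW => n.
  by rewrite ramp_le0// pmulr_rle0// subr_le0.
apply: cvg_near_cst; near=> n; rewrite ramp_ge1// -ler_pdivrMl// mulr1 ltW//.
by near: n; apply: (near_infty_natSinv_lt (PosNum _)); rewrite subr_gt0.
Unshelve. all: by end_near. Qed.

Lemma cvg_smooth_bump a b s : a <= b ->
  smooth_bump n.+1%:R a b s @[n --> \oo] --> (\1_`]a, b] s : R).
Proof.
move=> ab; have -> : \1_`]a, b] s = (a < s)%R%:R - (b < s)%R%:R :> R.
  rewrite indicE; have -> : (s \in `]a, b]%classic) = (a < s <= b).
    by rewrite mem_setE in_itv.
  have [bs|sb] := ltP b s; last by rewrite andbT subr0.
  by rewrite andbF (le_lt_trans ab bs) subrr.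
by apply: cvgB; exact: cvg_ramp.
Qed.

End hat_kernel.

(** * Weak derivatives as densities of primitives *)

Section weak_primitive.
Context {R : realType}.
Notation mu := (@lebesgue_measure R).
Implicit Types (f g u : R -> R) (a b L s : R).

(** On the bounded interval |u| <= 1 + u^2, and the right-hand side is integrable. *)
Lemma L2_integrable L u : L2 L u -> mu.-integrable setT (EFin \o (u \_ `]0, L[)).
Proof.
rewrite /L2 => uL2; have /= int2 := Lfun2_integrable_sqr uL2.
have mu_ : measurable_fun setT (u \_ `]0, L[) by have := sub_Lfun_mfun uL2; rewrite inE.
have mT : measurable (setT : set (measurableTypeR R)) by [].
have int1 := @integrable_indic_itv R 0 L false true.
apply: (le_integrable mT _ _ (integrable_EFinD mT int1 int2)).
  exact/measurable_EFinP.
move=> s _ /=; rewrite lee_fin [leRHS]ger0_norm ?addr_ge0 ?sqr_ge0//.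
have -> : \1_`]0, L[ s = (s \in `]0, L[%classic)%:R :> R by rewrite indicE.
rewrite patchE; case: ifP => _; last by rewrite normr0 expr0n addr0.
rewrite -[leRHS]/(1 + _) -real_normK ?num_real//.
have := normr_ge0 (u s); set v := `|u s|; nra.
Qed.

Lemma within_continuous_bounded f a b :
  {within `[a, b], continuous f} -> [bounded f s | s in `[a, b]].
Proof.
move=> cf.
have /compact_bounded[M [_ HM]] := continuous_compact cf (@segment_compact _ a b).
by exists M; split=> [|k Mk s sab]; [exact: num_real|apply: HM => //; exists s].
Qed.

Lemma integrable_mul_within_continuous L f u : L2 L u ->
  {within `[0, L], continuous f} -> mu.-integrable `]0, L[ (EFin \o (u \* f)).
Proof.
move=> /L2_integrable uL1 cf.
have intu : mu.-integrable `]0, L[ (EFin \o u).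
  by move: uL1; rewrite -restrict_EFin => /integrable_restrict; rewrite setTI; apply.
have -> : EFin \o (u \* f) = ((EFin \o u) \* (EFin \o f))%E by [].
apply: integrableMl => //.
- apply/measurable_EFinP; apply: measurable_int.
  exact: within_continuous_itv_oo_integrable cf.
- have [M [Mr HM]] := within_continuous_bounded cf.
  exists M; split => // x Mx y yL; apply: HM => //.
  exact: subset_itv_oo_cc.
Qed.

(** Test against the bumps: the approximate identity sends the left-hand side to f a - f b, and
    dominated convergence sends the right-hand side to minus the integral of [g] over ]a, b]. *)
Lemma weak_derivative_increment L f g a b :
  {within `[0, L], continuous f} -> mu.-integrable `]0, L[ (EFin \o g) ->
  weak_derivative L f g -> 0 < a -> a <= b -> b < L ->
  f b - f a = \int[mu]_(s in `]a, b]) (g \_ `]0, L[) s.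
Proof.
move=> cf intg fg a0 ab bL.
have aL : a < L by exact: le_lt_trans bL.
have b0 : 0 < b by exact: lt_le_trans ab.
have mI : measurable (`]0, L[ : set (measurableTypeR R)) by [].
pose phi n : R -> R := smooth_bump n.+1%:R a b.
have dphi n s : derive1 (phi n) s =
    n.+1%:R * hat (n.+1%:R * (s - a)) - n.+1%:R * hat (n.+1%:R * (s - b)).
  by rewrite derive1E; case: (is_derive_smooth_bump n.+1%:R a b s).
have lhs : \int[mu]_(s in `]0, L[) (f s * derive1 (phi n) s) @[n --> \oo] -->
    f a - f b.
  rewrite (_ : (fun n => _) = fun n =>
    \int[mu]_(s in `]0, L[) (f s * (n.+1%:R * hat (n.+1%:R * (s - a)))) -
    \int[mu]_(s in `]0, L[) (f s * (n.+1%:R * hat (n.+1%:R * (s - b))))).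
    by apply: cvgB; apply: cvg_Rintegral_hat; rewrite ?a0 ?b0.
  have ih n c : mu.-integrable `]0, L[
      (EFin \o (fun s => f s * (n.+1%:R * hat (n.+1%:R * (s - c))))).
    have ch := @hat_scaled_continuous R n.+1%:R c.
    apply: within_continuous_itv_oo_integrable => s; apply: cvgM; first exact: cf.
    exact: (continuous_subspaceT ch).
  apply/funext => n; rewrite -RintegralB//.
  by apply: eq_Rintegral => s _; rewrite dphi mulrBr.
have cphi n : continuous (phi n).
  move=> s; case: (is_derive_smooth_bump n.+1%:R a b s) => + _.
  by move=> /derivable1_diffP/differentiable_continuous.
have rhs : \int[mu]_(s in `]0, L[) (g s * phi n s) @[n --> \oo] -->
    \int[mu]_(s in `]0, L[) (g s * \1_`]a, b] s).
  have mg : measurable_fun `]0, L[ g by apply/measurable_EFinP; exact: measurable_int intg.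
  have mphi n : measurable_fun `]0, L[ (phi n).
    by apply: measurable_funTS; apply: continuous_measurable_fun; exact: cphi.
  have [] := @dominated_convergence _ _ R mu `]0, L[ mI
    (fun n s => (g s * phi n s)%:E) (fun s => (g s * \1_`]a, b] s)%:E)
    (fun s => `|g s|%:E).
  - by move=> n; apply/measurable_EFinP; have := measurable_funM mg (mphi n).
  - by apply/measurable_EFinP; apply: measurable_funM => //; exact: measurable_indic.
  - apply/aeW => s _; apply/cvg_EFin; first exact: nearW.
    by apply: cvgM; [exact: cvg_cst|exact: cvg_smooth_bump].
  - exact: integrable_norm.
  - apply/aeW => s n _; rewrite lee_fin normrM.
    by rewrite ler_piMr// smooth_bump_bound.
  move=> intl _ cvgl; apply: fine_cvg.
  by rewrite fineK//; exact: integrable_fin_num.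
(* The bump is known to be a test function once 1/(n+1) < L - b, so the identity is used for large
   [n] only. *)
have eqn : \forall n \near \oo, \int[mu]_(s in `]0, L[) (f s * derive1 (phi n) s) =
    - \int[mu]_(s in `]0, L[) (g s * phi n s).
  near=> n; apply: fg; apply: test_function_smooth_bump => //.
  rewrite -ltr_pdivrMl// mulr1.
  by near: n; apply: (near_infty_natSinv_lt (PosNum _)); rewrite subr_gt0.
have : f a - f b = - \int[mu]_(s in `]0, L[) (g s * \1_`]a, b] s).
  apply: (cvg_unique _ lhs) => //.
  by apply: cvg_trans (cvgN rhs); apply: near_eq_cvg; near do apply/esym.
move=> /eqP; rewrite -opprB eqr_opp => /eqP ->.
rewrite -Rintegral_mkcondr setIC Rintegral_mkcondr.
by apply: eq_Rintegral => s _; rewrite patchE indicE; case: ifP; rewrite ?mulr1 ?mulr0.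
Unshelve. all: by end_near. Qed.

(** Inside ]0, L[ the increments of [f] are those of a primitive of [g] extended by zero; continuity
    from the right carries the equality to 0. *)
Lemma weak_derivative_primitive L f g : 0 < L ->
  {within `[0, L], continuous f} -> mu.-integrable `]0, L[ (EFin \o g) ->
  weak_derivative L f g ->
  exists F, [/\ primitive F (g \_ `]0, L[), F 0 = f 0 &
    forall s, 0 < s < L -> F s = f s].
Proof.
move=> L0 cf intg fg.
have intgT : mu.-integrable setT (EFin \o (g \_ `]0, L[)).
  by rewrite -restrict_EFin; apply/integrable_restrict => //; rewrite setTI.
(* The increments are known only inside ]0, L[, so the additive constant is fixed at the
   midpoint. *)
pose m := L / 2; have [m0 mL] : 0 < m /\ m < L.
  by rewrite /m; split; [rewrite divr_gt0|rewrite ltr_pdivrMr// ltr_pMr// ltr1n].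
pose I s := \int[mu]_(x in `]-oo, s]) (g \_ `]0, L[) x.
pose F s := f m - I m + I s.
have pF : primitive F (g \_ `]0, L[) by exact: primitive_Rintegral.
have FE s : 0 < s < L -> F s = f s.
  move=> /andP[s0 sL]; have Fm : F m = f m by rewrite /F subrK.
  have [ms|/ltW sm] := leP m s.
    by have := pF.2 _ _ ms; rewrite -(weak_derivative_increment cf)// Fm; lra.
  by have := pF.2 _ _ sm; rewrite -(weak_derivative_increment cf)// Fm; lra.
exists F; split => //.
have /(continuous_within_itvP _ L0)[_ cf0 _] := cf.
have cF0 : F s @[s --> 0^'+] --> F 0.
  exact/cvg_at_right_filter/(primitive_continuous pF).
apply: (cvg_unique _ _ cf0) => //.
apply: cvg_trans cF0; apply: near_eq_cvg; near=> s; apply: FE.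
by apply/andP; split; near: s; [exact: nbhs_right_gt|exact: nbhs_right_lt].
Unshelve. all: by end_near. Qed.

End weak_primitive.

(** * Derivatives and antiderivatives *)

Section derivatives.
Context {R : realType}.
Notation mu := (@lebesgue_measure R).
Implicit Types (F f v W : R -> R) (a b c s : R).

Lemma is_derive1E (V : normedModType R) (F : R -> V) (x : R) (df : V) :
  is_derive x 1 F df <-> derivable F x 1 /\ F^`() x = df.
Proof.
by split=> [[dF <-]|[dF <-]]; [rewrite derive1E|apply: DeriveDef; rewrite ?derive1E].
Qed.

(** Lebesgue differentiation, as [F] differs by a constant from the integral of [f] over ]-oo,
    y]. *)
Lemma primitive_ae_is_derive F f : primitive F f ->
  {ae mu, forall s, is_derive s 1 F (f s)}.
Proof.
move=> [intf Ff]; have mT : measurable (setT : set (measurableTypeR R)) by [].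
have intNy y : mu.-integrable `]-oo, y] (EFin \o f) by exact: (integrableS mT _ _ intf).
have := FTC1Ny intNy (open_integrable_locally openT intf).
apply: filterS; first exact: (ae_filter_ringOfSetsType mu).
move=> s /= [dI Is].
pose I y := \int[mu]_(x in `]-oo, y]) f x.
have FE : F = (fun y => (F 0 - I 0) + I y).
  apply/funext => y; have [_ pI] := primitive_Rintegral 0 intf.
  have [y0|/ltW y0] := leP 0 y.
    by have := Ff _ _ y0; rewrite -pI// -/(I _) -/(I _); lra.
  by have := Ff _ _ y0; rewrite -pI// -/(I _) -/(I _); lra.
rewrite FE -[f s]add0r.
have -> : (fun y => F 0 - I 0 + I y) = cst (F 0 - I 0) + I by apply/funext.
by apply: is_deriveD; apply/is_derive1E.
Qed.

Lemma itv_oo_nbhs a b s : a < s < b -> \forall r \near s, a < r < b.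
Proof.
move=> /andP[as_ sb]; near=> r; apply/andP.
by split; near: r; [exact: lt_nbhsr|exact: lt_nbhsl].
Unshelve. all: by end_near. Qed.

Lemma continuous_itv_oo_integrable v a b c d :
  (forall s, a < s < b -> {for s, continuous v}) ->
  a < c -> d < b -> mu.-integrable `[c, d] (EFin \o v).
Proof.
move=> cv ac db; apply: continuous_compact_integrable; first exact: segment_compact.
apply: continuous_in_subspaceT => r; rewrite mem_setE in_itv/= => /andP[cr rd].
by apply: cv; rewrite (lt_le_trans ac cr) (le_lt_trans rd db).
Qed.

Lemma continuous_Rintegral_is_derive v a b c s :
  (forall s, a < s < b -> {for s, continuous v}) -> a < c -> c < s -> s < b ->
  is_derive s 1 (fun r => \int[mu]_(x in `]c, r]) v x) (v s).
Proof.
(* Continuity on the open interval gives no integrability up to [b], so the integration window stops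
   at a point between [s] and [b]. *)
move=> cv ac cs sb; pose u := (s + b) / 2.
have [su ub] : s < u /\ u < b by rewrite /u; split; lra.
apply/is_derive1E; apply: (continuous_FTC1 su) => //.
  apply: integrableS (continuous_itv_oo_integrable cv ac ub) => //.
  exact: subset_itv_oc_cc.
by apply: cv; rewrite (lt_trans ac cs).
Qed.

(** Replacing [f] by [v] leaves the integrals unchanged, and the integral of a continuous function
    is differentiable at every point, not just almost everywhere. *)
Lemma primitive_is_derive F f v a b : primitive F f ->
  {ae mu, forall s, a < s < b -> f s = v s} ->
  (forall s, a < s < b -> {for s, continuous v}) ->
  forall s, a < s < b -> is_derive s 1 F (v s).
Proof.
move=> [intf Ff] fv cv s /andP[as_ sb]; pose c := (a + s) / 2.
have [ac cs] : a < c /\ c < s by rewrite /c; split; lra.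
have dI := continuous_Rintegral_is_derive cv ac cs sb.
apply: (@near_eq_is_derive _ _ _ (cst (F c) + (fun r => \int[mu]_(x in `]c, r]) v x))).
  have : \forall r \near s, c < r < b by apply: itv_oo_nbhs; rewrite cs.
  apply: filterS => r /andP[cr rb]; rewrite [LHS]/=.
  apply/esym/eqP; rewrite addrC -subr_eq; apply/eqP; rewrite Ff ?ltW//.
  have mI : measurable (`]c, r] : set (measurableTypeR R)) by [].
  congr fine; apply: ae_eq_integral => //.
  - by apply: measurable_int; exact: (integrableS _ _ _ intf).
  - apply: (measurable_int mu).
    apply: integrableS (continuous_itv_oo_integrable cv ac rb) => //.
    exact: subset_itv_oc_cc.
  - apply: filterS fv; first exact: (ae_filter_ringOfSetsType mu).
    move=> x /= fvx; rewrite in_itv/= => /andP[cx xr].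
    by rewrite fvx// (lt_trans ac cx) (le_lt_trans xr rb).
rewrite -[v s]add0r; exact: is_deriveD.
Qed.

Lemma is_derive_0_cst_oo F a b : (forall s, a < s < b -> is_derive s 1 F 0) ->
  forall x y : R, a < x < b -> a < y < b -> F x = F y.
Proof.
move=> F0; suff key (x y : R) : a < x < b -> a < y < b -> x <= y -> F x = F y.
  move=> x y xab yab; have [xy|/ltW yx] := leP x y; first exact: key.
  by apply/esym/key.
move=> /andP[ax xb] /andP[ay yb] xy.
have dF (r : R) : r \in `[x, y]%R -> is_derive r 1 F 0.
  rewrite in_itv/= => /andP[xr ry].
  by apply: F0; rewrite (lt_le_trans ax xr) (le_lt_trans ry yb).
have cF : {within `[x, y], continuous F}.
  by apply: derivable_within_continuous => r /dF[].
have dF' r : r \in `]x, y[%R -> is_derive r 1 F (cst 0 r).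
  by move=> /subset_itv_oo_cc; exact: dF.
have [r _ /eqP] := @MVT_segment R F (cst 0) x y xy dF' cF.
by rewrite mul0r subr_eq0 => /eqP.
Qed.

(** When both one-sided limits exist, [v] is extended continuously to [a, b] and integrated from
    [a], which yields continuity at the endpoints. *)
Lemma continuous_antiderivative_oo v a b : a < b ->
  (forall s, a < s < b -> {for s, continuous v}) ->
  exists V : R -> R, (forall s, a < s < b -> is_derive s 1 V (v s)) /\
    (cvg (v s @[s --> a^'+]) -> cvg (v s @[s --> b^'-]) ->
     {within `[a, b], continuous V}).
Proof.
move=> ab cv.
have [[ca cb]|ncvg] := pselect (cvg (v s @[s --> a^'+]) /\ cvg (v s @[s --> b^'-])).
  pose W s := if s == a then lim (v r @[r --> a^'+]) else
              if s == b then lim (v r @[r --> b^'-]) else v s.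
  have Wv s : a < s < b -> W s = v s.
    by move=> /andP[as_ sb]; rewrite /W gt_eqF// lt_eqF.
  have cW s : a < s < b -> {for s, continuous W}.
    move=> sab; rewrite /prop_for /continuous_at (Wv s)//.
    apply: cvg_trans (cv _ sab); apply: near_eq_cvg.
    by have := itv_oo_nbhs sab; apply: filterS => r /Wv.
  have wW : {within `[a, b], continuous W}.
    apply/(continuous_within_itvP _ ab); split.
    - by move=> s; rewrite in_itv/=; exact: cW.
    - have -> : W a = lim (v r @[r --> a^'+]) by rewrite /W eqxx.
      apply: cvg_trans ca; apply: near_eq_cvg.
      near=> r; rewrite /= ?Wv//; apply/andP; split; near: r;
        [exact: nbhs_right_gt|exact: nbhs_right_lt].
    - have -> : W b = lim (v r @[r --> b^'-]) by rewrite /W eqxx gt_eqF.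
      apply: cvg_trans cb; apply: near_eq_cvg.
      near=> r; rewrite /= ?Wv//; apply/andP; split; near: r;
        [exact: nbhs_left_gt|exact: nbhs_left_lt].
  have intW := continuous_compact_integrable (@segment_compact _ a b) wW.
  exists (fun s => \int[mu]_(x in `[a, s]) W x); split.
    move=> s sab; have /andP[as_ sb] := sab.
    rewrite -(Wv s sab).
    apply/is_derive1E.
    by apply: (continuous_FTC1_closed sb) => //; exact: cW.
  by move=> _ _; exact: parameterized_integral_continuous (ltW ab) intW.
(* Otherwise [v] may fail to be integrable up to [a] or [b], and [V] is its signed integral from the
   midpoint; the claim at the endpoints is then vacuous. *)
pose m := (a + b) / 2; have [am mb] : a < m /\ m < b by rewrite /m; split; lra.
pose V s := if m <= s then \int[mu]_(x in `]m, s]) v x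
            else - \int[mu]_(x in `]s, m]) v x.
exists V; split; last by move=> ca cb; case: ncvg.
(* [c] lies to the left of both [s] and [m], so near [s] both branches of [V] are the integral from
   [c] minus its value at [m]. *)
move=> s /andP[as_ sb]; pose c := (a + Num.min s m) / 2.
have [ac cs cm] : [/\ a < c, c < s & c < m].
  by rewrite /c; have [sm|ms] := leP s m; split; lra.
have dI := continuous_Rintegral_is_derive cv ac cs sb.
pose J r := \int[mu]_(x in `]c, r]) v x.
apply: (@near_eq_is_derive _ _ _ (cst (- J m) + J)); last first.
  by rewrite -[v s]add0r; exact: is_deriveD.
have : \forall r \near s, c < r < b by apply: itv_oo_nbhs; rewrite cs.
apply: filterS => r /andP[cr rb]; rewrite [LHS]/= /V.
have itvB (x y : R) : c < x -> x <= y -> y < b ->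
    J y - J x = \int[mu]_(z in `]x, y]) v z.
  move=> cx xy yb; apply: Rintegral_itvB; rewrite ?bnd_simp//; last exact: ltW.
  apply: integrableS (continuous_itv_oo_integrable cv ac yb) => //.
  exact: subset_itv_oc_cc.
case: ifPn => [mr|]; first by rewrite -itvB// addrC.
by rewrite -ltNge => rm; rewrite -itvB// ?ltW// opprB addrC.
Unshelve. all: by end_near. Qed.

Lemma is_derive_invsqrt (x : R) : 0 < x ->
  is_derive x 1 (fun y => (Num.sqrt y)^-1) (- (Num.sqrt x)^-1 ^+ 3 / 2).
Proof.
move=> x0; apply: (@near_eq_is_derive _ _ _ (fun y => y `^ (- 2^-1) : R)).
  have := lt_nbhsr x0; apply: filterS => y y0.
  by rewrite powRN powR12_sqrt// ltW.
apply: (is_derive_eq (is_derive1_powR (- 2^-1) x0)).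
rewrite powRB; last by rewrite (gt_eqF x0) implybT.
rewrite powRr1 ?ltW// powRN powR12_sqrt ?ltW//.
have sx : Num.sqrt x != 0 by rewrite gt_eqF// sqrtr_gt0.
by rewrite -{2}(sqr_sqrtr (ltW x0)); field.
Qed.

End derivatives.

(** * Lifting to the angle *)

Section circle_lift.
Context {R : realType}.
Implicit Types (p q : R -> R) (a b s : R).

(** The angle is [acos p], taken with the sign of [q]. *)
Lemma angle_of_unit (p q : R) : p ^+ 2 + q ^+ 2 = 1 ->
  exists theta : R, p = cos theta /\ q = sin theta.
Proof.
move=> pq1.
have p1 : -1 <= p <= 1.
  have := sqr_ge0 q; rewrite -ler_norml -(ler_sqr (normr_ge0 _)) ?nnegrE//.
  by rewrite real_normK ?num_real// expr1n; lra.
have qE : Num.sqrt (1 - p ^+ 2) = `|q| by rewrite -pq1 addrC addKr sqrtr_sqr.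
have cosE : cos (acos p) = p by apply: acosK; rewrite in_itv.
have [q0|q0] := leP 0 q.
  by exists (acos p); rewrite cosE sin_acos// qE ger0_norm.
by exists (- acos p); rewrite cosN sinN cosE sin_acos// qE ltr0_norm// opprK.
Qed.

(** [theta] is the antiderivative of the angular speed [w] with the right value at the midpoint. The
    coordinates C = p cos theta + q sin theta and S = q cos theta - p sin theta of (p, q) in the
    axes turned by [theta] have zero derivative, hence stay equal to 1 and 0. *)
Lemma circle_lift p q dp dq a b (w := fun s => p s * dq s - q s * dp s) :
  a < b ->
  (forall s, a < s < b -> is_derive s 1 p (dp s)) ->
  (forall s, a < s < b -> is_derive s 1 q (dq s)) ->
  (forall s, a < s < b -> p s ^+ 2 + q s ^+ 2 = 1) ->
  (forall s, a < s < b -> {for s, continuous w}) ->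
  exists theta : R -> R,
    [/\ forall s, a < s < b -> is_derive s 1 theta (w s),
        forall s, a < s < b -> p s = cos (theta s) /\ q s = sin (theta s) &
        cvg (w s @[s --> a^'+]) -> cvg (w s @[s --> b^'-]) ->
          {within `[a, b], continuous theta}].
Proof.
move=> ab derp derq pq1 cw.
have [V [derV cV]] := continuous_antiderivative_oo ab cw.
pose m := (a + b) / 2; have mab : a < m < b by rewrite /m; apply/andP; split; lra.
have [th0 [pm qm]] := angle_of_unit (pq1 m mab).
pose theta : R -> R := cst (th0 - V m) + V.
have dertheta s : a < s < b -> is_derive s 1 theta (w s).
  by move=> sab; rewrite -[w s]add0r; apply: is_deriveD; exact: derV.
have thetam : theta m = th0 by rewrite /theta /= /GRing.add/= subrK.
have pq0 s : a < s < b -> p s * dp s + q s * dq s = 0.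
  move=> sab; have [dps dqs] := (derp s sab, derq s sab).
  have d2 : is_derive s 1 (p * p + q * q)
    (p s *: dp s + p s *: dp s + (q s *: dq s + q s *: dq s)).
    exact: is_deriveD.
  have d1 : is_derive s 1 (cst 1 : R -> R)
    (p s *: dp s + p s *: dp s + (q s *: dq s + q s *: dq s)).
    apply: near_eq_is_derive d2; have := itv_oo_nbhs sab; apply: filterS => r rab.
    by rewrite /= -(pq1 r rab) !expr2.
  have := @derive_val _ _ _ _ _ _ _ d1.
  by rewrite derive_cst /GRing.scale/=; lra.
pose co := cos \o theta; pose si := sin \o theta.
have dco s : a < s < b -> is_derive s 1 co (- sin (theta s) * w s).
  by move=> sab; apply: is_derive1_comp; exact: dertheta.
have dsi s : a < s < b -> is_derive s 1 si (cos (theta s) * w s).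
  by move=> sab; apply: is_derive1_comp; exact: dertheta.
pose C := p * co + q * si; pose S := q * co - p * si.
have C0 s : a < s < b -> is_derive s 1 C 0.
  move=> sab.
  have [dps dqs] := (derp s sab, derq s sab); have := pq0 s sab; have := pq1 s sab.
  have dcs := dco s sab; have dss := dsi s sab.
  move=> e1 e0.
  apply: (is_derive_eq (is_deriveD (is_deriveM dps dcs) (is_deriveM dqs dss))).
  rewrite /co /si /GRing.scale/= /w.
  set c := cos _; set z := sin _.
  (* The terms are grouped into multiples of 1 - (p^2 + q^2) and of p p' + q q', which both
     vanish. *)
  have -> : p s * (- z * (p s * dq s - q s * dp s)) + c * dp s +
    (q s * (c * (p s * dq s - q s * dp s)) + z * dq s) =
    z * (dq s * (1 - (p s ^+ 2 + q s ^+ 2)) + q s * (p s * dp s + q s * dq s)) +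
    c * (dp s * (1 - (p s ^+ 2 + q s ^+ 2)) + p s * (p s * dp s + q s * dq s)) by ring.
  by rewrite e1 e0 subrr; ring.
have S0 s : a < s < b -> is_derive s 1 S 0.
  move=> sab.
  have [dps dqs] := (derp s sab, derq s sab); have := pq0 s sab; have := pq1 s sab.
  have dcs := dco s sab; have dss := dsi s sab.
  move=> e1 e0.
  apply: (is_derive_eq (is_deriveB (is_deriveM dqs dcs) (is_deriveM dps dss))).
  rewrite /co /si /GRing.scale/= /w.
  set c := cos _; set z := sin _.
  have -> : q s * (- z * (p s * dq s - q s * dp s)) + c * dq s -
    (p s * (c * (p s * dq s - q s * dp s)) + z * dp s) =
    c * (dq s * (1 - (p s ^+ 2 + q s ^+ 2)) + q s * (p s * dp s + q s * dq s)) -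
    z * (dp s * (1 - (p s ^+ 2 + q s ^+ 2)) + p s * (p s * dp s + q s * dq s)) by ring.
  by rewrite e1 e0 subrr; ring.
have Cm : C m = 1.
  by rewrite /C /co /si -[LHS]/(p m * cos (theta m) + q m * sin (theta m)) thetam pm qm
    -!expr2 cos2Dsin2.
have Sm : S m = 0.
  rewrite /S /co /si -[LHS]/(q m * cos (theta m) - p m * sin (theta m)) thetam pm qm.
  by ring.
exists theta; split; first exact: dertheta.
- move=> s sab; have := is_derive_0_cst_oo S0 sab mab.
  have := is_derive_0_cst_oo C0 sab mab; rewrite Cm Sm.
  rewrite /C /S -[(p * co + q * si) s]/(p s * cos (theta s) + q s * sin (theta s)).
  rewrite -[(q * co - p * si) s]/(q s * cos (theta s) - p s * sin (theta s)).
  have := cos2Dsin2 (theta s).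
  set c := cos _; set z := sin _ => e e1 e2; split.
    (* Rotating back recovers [p], and below [q], from C = 1 and S = 0. *)
    have -> : p s = (p s * c + q s * z) * c - (q s * c - p s * z) * z +
      p s * (1 - (c ^+ 2 + z ^+ 2)) by ring.
    by rewrite e1 e2 e; ring.
  have -> : q s = (p s * c + q s * z) * z + (q s * c - p s * z) * c +
      q s * (1 - (c ^+ 2 + z ^+ 2)) by ring.
  by rewrite e1 e2 e; ring.
- move=> ca cb s; apply: cvgD; first exact: cvg_cst.
  exact: (cV ca cb).
Qed.

End circle_lift.

(** * Algebra of orthonormal frames in R^3 *)

Section frame_algebra.
Context {R : realType}.
Implicit Types u v w x : 'rV[R]_3.

(** The last index is written 1 + 1, the form in which the cyclic indices of [cross] produce it. *)
Lemma ord3_ind (P : 'I_3 -> Prop) : P 0 -> P 1 -> P (1 + 1) -> forall i, P i.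
Proof.
by move=> P0 P1 P2 [[|[|[|//]]] i3];
  [move: P0|move: P1|move: P2]; congr P; apply: val_inj.
Qed.

Lemma dotC u v : dot u v = dot v u.
Proof. by apply: eq_bigr => i _; rewrite mulrC. Qed.

Lemma dotE u v : dot u v = u 0 0 * v 0 0 + u 0 1 * v 0 1 + u 0 (1 + 1) * v 0 (1 + 1).
Proof.
rewrite /dot !big_ord_recl big_ord0 addr0 addrA.
by congr (_ + _ * _ + _ * _); congr (_ _ _); apply: val_inj.
Qed.

Lemma crossE u v : [/\ cross u v 0 0 = u 0 1 * v 0 (1 + 1) - u 0 (1 + 1) * v 0 1,
  cross u v 0 1 = u 0 (1 + 1) * v 0 0 - u 0 0 * v 0 (1 + 1) &
  cross u v 0 (1 + 1) = u 0 0 * v 0 1 - u 0 1 * v 0 0].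
Proof.
have e3 : 1 + 1 + 1 = 0 :> 'I_3 by apply: val_inj.
have e4 : 1 + 1 + 1 + 1 = 1 :> 'I_3 by apply: val_inj.
by split; rewrite mxE ?add0r ?e3 ?e4 ?add0r.
Qed.

(** For the square matrix M with rows u, v, w, M M^T = 1 and M^T M = 1 are equivalent. The column
    form is the one whose entries the frame system visibly preserves. *)
Lemma orthonormal3P u v w : orthonormal3 u v w <->
  forall i j, u 0 i * u 0 j + v 0 i * v 0 j + w 0 i * w 0 j = (i == j)%:R.
Proof.
pose M := \matrix_(k < 3, i < 3) [:: u; v; w]`_k 0 i.
have -> : (forall i j, u 0 i * u 0 j + v 0 i * v 0 j + w 0 i * w 0 j = (i == j)%:R)
    <-> M^T *m M = 1%:M.
  split=> [H|/matrixP H i j].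
    by apply/matrixP => i j; rewrite !mxE !big_ord_recl big_ord0 !mxE/= -H addr0 addrA.
  by have := H i j; rewrite !mxE !big_ord_recl big_ord0 !mxE/= addr0 addrA.
have -> : orthonormal3 u v w <-> M *m M^T = 1%:M.
  have ME (k l : 'I_3) : (M *m M^T) k l = dot [:: u; v; w]`_k [:: u; v; w]`_l.
    by rewrite !mxE; apply: eq_bigr => i _; rewrite !mxE.
  split=> [[[uu vv ww] [uv uw vw]]|/matrixP H].
    apply/matrixP; apply: ord3_ind; apply: ord3_ind; rewrite ME mxE /= //;
    by rewrite dotC.
  split; split.
  - by have := H 0 0; rewrite ME mxE.
  - by have := H 1 1; rewrite ME mxE.
  - by have := H (1 + 1) (1 + 1); rewrite ME mxE.
  - by have := H 0 1; rewrite ME mxE.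
  - by have := H 0 (1 + 1); rewrite ME mxE.
  - by have := H 1 (1 + 1); rewrite ME mxE.
by split; exact: mulmx1C.
Qed.

Lemma orthonormal3_decomp u v w x : orthonormal3 u v w ->
  x = dot x u *: u + dot x v *: v + dot x w *: w.
Proof.
move=> /orthonormal3P H; apply/rowP => j; rewrite !mxE.
transitivity (\sum_(i < 3) x 0 i * (i == j)%:R).
  by rewrite (bigD1 j)//= eqxx mulr1 big1 ?addr0// => i /negbTE ->; rewrite mulr0.
rewrite /dot !mulr_suml -!big_split; apply: eq_bigr => i _ /=.
by rewrite -H; ring.
Qed.

Lemma dot_comb u v w (a b : R) :
  dot (a *: u + b *: v) w = a * dot u w + b * dot v w.
Proof. by rewrite !dotE !mxE; ring. Qed.

(** The cross product is orthogonal to [u] and [v], hence a multiple of [w]; Lagrange's identity |u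
    x v|^2 = |u|^2 |v|^2 - (u . v)^2 gives the square of the coefficient. *)
Lemma orthonormal3_cross u v w : orthonormal3 u v w ->
  cross u v = dot (cross u v) w *: w /\ dot (cross u v) w ^+ 2 = 1.
Proof.
move=> /[dup] O [[uu vv ww] [uv uw vw]].
have cu : dot (cross u v) u = 0.
  by rewrite dotE; case: (crossE u v) => -> -> ->; ring.
have cv : dot (cross u v) v = 0.
  by rewrite dotE; case: (crossE u v) => -> -> ->; ring.
have E : cross u v = dot (cross u v) w *: w.
  by rewrite {1}(orthonormal3_decomp (cross u v) O) cu cv !scale0r !add0r.
split=> //.
have lag : dot (cross u v) (cross u v) = dot u u * dot v v - dot u v ^+ 2.
  by rewrite !dotE; case: (crossE u v) => -> -> ->; ring.
rewrite uu vv uv mul1r expr0n subr0 in lag.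
have <- : dot (cross u v) (dot (cross u v) w *: w) = dot (cross u v) w ^+ 2.
  by rewrite !dotE !mxE; ring.
by rewrite -E.
Qed.

Lemma cross_comb u v w (a b : R) :
  cross u (a *: v + b *: w) = a *: cross u v + b *: cross u w.
Proof. by apply/rowP => i; rewrite !mxE; ring. Qed.

Lemma cross_crossr u v : cross u (cross u v) = dot u v *: u - dot u u *: v.
Proof.
case: (crossE u v) => c0 c1 c2; case: (crossE u (cross u v)) => d0 d1 d2.
have rhsE i : (dot u v *: u - dot u u *: v) 0 i = dot u v * u 0 i - dot u u * v 0 i.
  by rewrite !mxE.
apply/rowP; apply: ord3_ind; rewrite rhsE.
- by rewrite d0 c1 c2 !dotE; ring.
- by rewrite d1 c0 c2 !dotE; ring.
- by rewrite d2 c0 c1 !dotE; ring.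
Qed.

(** For the frame t, d1, d2 and the normal p d1 - q d2 this gives the binormal; the computation
    rests on u x w = u x (u x v) = - v. *)
Lemma cross_frame u v w (a b : R) : orthonormal3 u v w -> cross u v = w ->
  cross u (a *: v - b *: w) = b *: v + a *: w.
Proof.
move=> [[uu _ _] [uv _ _]] uvw; rewrite -scaleNr cross_comb uvw -{2}uvw.
by rewrite cross_crossr uu uv scale0r scale1r sub0r scalerN scaleNr opprK addrC.
Qed.

End frame_algebra.

(** * The frame and the angle *)

Section vector_calculus.
Context {R : realType}.
Implicit Types (s : R).

Lemma is_derive_rowP n (f : R -> 'rV[R]_n.+1) s (df : 'rV[R]_n.+1) :
  is_derive s 1 f df <-> forall i, is_derive s 1 (fun r => f r 0 i) (df 0 i).
Proof.
split=> [[dF <-] i|H].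
  apply: DeriveDef; first exact: (derivable_mxP _ _ _).1.
  by rewrite derive_mx// mxE.
have dF : derivable f s 1.
  by apply/derivable_mxP => i j; rewrite ord1; case: (H j).
apply: DeriveDef => //; rewrite derive_mx//; apply/rowP => j; rewrite mxE.
by apply: derive_val; exact: H.
Qed.

Lemma is_derive_continuous (V : normedModType R) (f : R -> V) s df :
  is_derive s 1 f df -> {for s, continuous f}.
Proof. by move=> [/derivable1_diffP/differentiable_continuous]. Qed.

Lemma cvg_coord n (T : Type) (F : set_system T) {FF : Filter F}
    (f : T -> 'rV[R]_n.+1) (l : 'rV[R]_n.+1) :
  f @ F --> l -> forall i, f r 0 i @[r --> F] --> l 0 i.
Proof.
move=> fl i; apply: (@cvg_comp _ _ _ f (fun M : 'rV[R]_n.+1 => M 0 i) F (nbhs l)) => //.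
exact: coord_continuous.
Qed.

Lemma cvg_dot (T : Type) (F : set_system T) {FF : Filter F}
    (f g : T -> 'rV[R]_3) (l m : 'rV[R]_3) :
  (forall i, f r 0 i @[r --> F] --> l 0 i) ->
  (forall i, g r 0 i @[r --> F] --> m 0 i) ->
  dot (f r) (g r) @[r --> F] --> dot l m.
Proof.
move=> fl gm; rewrite dotE; under eq_fun do rewrite dotE.
by apply: cvgD; first apply: cvgD; exact: cvgM.
Qed.

Lemma is_derive_dot (f g : R -> 'rV[R]_3) s (df dg : 'rV[R]_3) :
  is_derive s 1 f df -> is_derive s 1 g dg ->
  is_derive s 1 (fun r => dot (f r) (g r)) (dot df (g s) + dot (f s) dg).
Proof.
move=> /is_derive_rowP df_ /is_derive_rowP dg_.
have dm i := is_deriveM (df_ i) (dg_ i).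
have := is_deriveD (is_deriveD (dm 0) (dm 1)) (dm (1 + 1)).
rewrite (_ : (_ + _ + _)%R = (fun r => dot (f r) (g r))); last first.
  by apply/funext => r; rewrite dotE.
by move/is_derive_eq; apply; rewrite !dotE /GRing.scale/=; ring.
Qed.

Lemma is_derive_comb (a b : R -> R) (f g : R -> 'rV[R]_3) s da db (df dg : 'rV[R]_3) :
  is_derive s 1 a da -> is_derive s 1 b db ->
  is_derive s 1 f df -> is_derive s 1 g dg ->
  is_derive s 1 (fun r => a r *: f r + b r *: g r)
    (da *: f s + a s *: df + (db *: g s + b s *: dg)).
Proof.
move=> da_ db_ /is_derive_rowP df_ /is_derive_rowP dg_; apply/is_derive_rowP => i.
have := is_deriveD (is_deriveM da_ (df_ i)) (is_deriveM db_ (dg_ i)).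
rewrite (_ : (_ + _)%R = (fun r => (a r *: f r + b r *: g r) 0 i)); last first.
  by apply/funext => r; rewrite !mxE.
by move/is_derive_eq; apply; rewrite !mxE /GRing.scale/=; ring.
Qed.

Lemma is_derive_inj (f g : R -> R) s df dg : {near s, f =1 g} ->
  is_derive s 1 f df -> is_derive s 1 g dg -> df = dg.
Proof.
by move=> fg [_ <-] [_ <-]; exact: near_eq_derive.
Qed.

End vector_calculus.

(** * The angle between the Frenet frame and the frame t, d1, d2 *)

Section frenet_angle.
Context {R : realType}.
Variables (L : R) (T D1 D2 X2 X3 : R -> 'rV[R]_3).
Let v1 s := - dot (X2 s) (D2 s).
Let v2 s := dot (X2 s) (D1 s).
(** This is (v2 v1' - v1 v2') / |x''|^2 with v1' = - x''' . d2 and v2' = x''' . d1 inserted, so that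
    no derivative of [v1] or [v2] remains. *)
Definition angle_speed s := (dot (X2 s) (X2 s))^-1 *
  (dot (X2 s) (D2 s) * dot (X3 s) (D1 s) - dot (X2 s) (D1 s) * dot (X3 s) (D2 s)).
Hypothesis L0 : 0 < L.
Hypothesis derT : forall s : R, 0 < s < L -> is_derive s 1 T (X2 s).
Hypothesis derX2 : forall s : R, 0 < s < L -> is_derive s 1 X2 (X3 s).
Hypothesis contX3 : forall s : R, 0 < s < L -> {for s, continuous X3}.
Hypothesis derD1 : forall s : R, 0 < s < L -> is_derive s 1 D1 (- (v2 s *: T s)).
Hypothesis derD2 : forall s : R, 0 < s < L -> is_derive s 1 D2 (v1 s *: T s).
Hypothesis contD1 : forall i, continuous (fun s => D1 s 0 i).
Hypothesis contD2 : forall i, continuous (fun s => D2 s 0 i).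
Hypothesis orthoTD : forall s : R, 0 < s < L -> orthonormal3 (T s) (D1 s) (D2 s).
Hypothesis crossTD : forall s : R, 0 < s < L -> cross (T s) (D1 s) = D2 s.
Hypothesis X2_neq0 : forall s : R, 0 < s < L -> enorm (X2 s) != 0.

Lemma enorm_neq0 (u : 'rV[R]_3) : enorm u != 0 -> 0 < dot u u.
Proof. by rewrite /enorm sqrtr_eq0 -ltNge. Qed.

(** A general filter covers both continuity inside ]0, L[ and the one-sided limits at 0 and L. *)
Lemma cvg_angle_derivative (F : set_system R) {FF : Filter F} (l2 l3 : 'rV[R]_3) (c : R) :
  X2 r @[r --> F] --> l2 -> X3 r @[r --> F] --> l3 -> enorm l2 != 0 ->
  F --> c ->
  angle_speed r @[r --> F] --> (dot l2 l2)^-1 *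
    (dot l2 (D2 c) * dot l3 (D1 c) - dot l2 (D1 c) * dot l3 (D2 c)).
Proof.
move=> /cvg_coord cX2 /cvg_coord cX3 /enorm_neq0/lt0r_neq0 l20 Fc.
have cD1 i : D1 r 0 i @[r --> F] --> D1 c 0 i 
  by apply: (@cvg_comp _ _ _ id (fun r => D1 r 0 i) F (nbhs c)) => //; exact: contD1.
have cD2 i : D2 r 0 i @[r --> F] --> D2 c 0 i 
  by apply: (@cvg_comp _ _ _ id (fun r => D2 r 0 i) F (nbhs c)) => //; exact: contD2.
apply: cvgM; first by apply: cvgV; [exact: l20|exact: cvg_dot].
by apply: cvgB; apply: cvgM; exact: cvg_dot.
Qed.

(** Differentiating |t|^2 = 1 removes the tangential component. *)
Lemma X2_decomp s : 0 < s < L -> X2 s = v2 s *: D1 s - v1 s *: D2 s.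
Proof.
move=> sL; have dTT := is_derive_dot (derT sL) (derT sL).
have TT1 : \forall r \near s, dot (T r) (T r) = cst 1 r.
  by have := itv_oo_nbhs sL; apply: filterS => r /orthoTD[[]].
have X2T : dot (X2 s) (T s) = 0.
  have := is_derive_inj TT1 dTT (is_derive_cst _ _ _).
  by rewrite (dotC (T s)); lra.
rewrite {1}(orthonormal3_decomp (X2 s) (orthoTD sL)) X2T scale0r add0r.
by rewrite /v2 /v1 scaleNr opprK.
Qed.

Lemma frenet_angle : exists theta : R -> R,
  [/\ forall s : R, 0 < s < L -> is_derive s 1 theta (angle_speed s),
      forall s : R, 0 < s < L -> v1 s = enorm (X2 s) * sin (theta s) /\
                             v2 s = enorm (X2 s) * cos (theta s),
      forall s : R, 0 < s < L ->
        is_derive s 1 (fun r => cross (T r) ((enorm (X2 r))^-1 *: X2 r))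
          (angle_speed s *: ((enorm (X2 s))^-1 *: X2 s)) &
      cvg (angle_speed s @[s --> 0^'+]) -> cvg (angle_speed s @[s --> L^'-]) ->
        {within `[0, L], continuous theta}].
Proof.
pose sg s := (enorm (X2 s))^-1.
pose dsg s := - sg s ^+ 3 * dot (X3 s) (X2 s).
have dersg s : 0 < s < L -> is_derive s 1 sg (dsg s).
  move=> sL; have X20 := enorm_neq0 (X2_neq0 sL).
  have dd := is_derive_dot (derX2 sL) (derX2 sL).
  have := is_derive1_comp (is_derive_invsqrt X20) dd.
  move/is_derive_eq; apply; rewrite -/(enorm _) -/(sg s) /dsg.
  by rewrite (dotC (X2 s)); field.
(* The derivatives of [D1] and [D2] are tangential, hence orthogonal to [X2]: only [X3] contributes
   to the derivatives of [v1] and [v2]. *)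
pose dv1 s := - dot (X3 s) (D2 s); pose dv2 s := dot (X3 s) (D1 s).
have X2T s : 0 < s < L -> dot (X2 s) (T s) = 0.
  move=> sL; have [_ [TD1 TD2 _]] := orthoTD sL.
  by rewrite X2_decomp// -scaleNr dot_comb !(dotC _ (T s)) TD1 TD2 !mulr0 addr0.
have derv1 s : 0 < s < L -> is_derive s 1 v1 (dv1 s).
  move=> sL; have := is_deriveN (is_derive_dot (derX2 sL) (derD2 sL)).
  move/is_derive_eq; apply; rewrite /dv1.
  have -> : dot (X2 s) (v1 s *: T s) = v1 s * dot (X2 s) (T s).
    by rewrite !dotE !mxE; ring.
  by rewrite X2T// mulr0 addr0.
have derv2 s : 0 < s < L -> is_derive s 1 v2 (dv2 s).
  move=> sL; have := is_derive_dot (derX2 sL) (derD1 sL).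
  move/is_derive_eq; apply; rewrite /dv2.
  have -> : dot (X2 s) (- (v2 s *: T s)) = - v2 s * dot (X2 s) (T s).
    by rewrite !dotE !mxE; ring.
  by rewrite X2T// mulr0 addr0.
pose p := sg * v2; pose q := sg * v1.
pose dp s := sg s *: dv2 s + v2 s *: dsg s; pose dq s := sg s *: dv1 s + v1 s *: dsg s.
have derp s : 0 < s < L -> is_derive s 1 p (dp s).
  by move=> sL; exact: is_deriveM (dersg s sL) (derv2 s sL).
have derq s : 0 < s < L -> is_derive s 1 q (dq s).
  by move=> sL; exact: is_deriveM (dersg s sL) (derv1 s sL).
have sg2 s : sg s ^+ 2 = (dot (X2 s) (X2 s))^-1.
  rewrite /sg exprVn sqr_sqrtr//.
  by apply: sumr_ge0 => i _; rewrite -expr2 sqr_ge0.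
(* The terms carrying the derivative of [sg] cancel, which leaves sg^2 (v2 v1' - v1 v2'). *)
have wE s : p s * dq s - q s * dp s = angle_speed s.
  rewrite /angle_speed -sg2 /dp /dq /dv1 /dv2 /GRing.scale/=.
  rewrite -[p s]/(sg s * v2 s) -[q s]/(sg s * v1 s) /v1 /v2; ring.
have pq1 s : 0 < s < L -> p s ^+ 2 + q s ^+ 2 = 1.
  move=> sL; have X20 := enorm_neq0 (X2_neq0 sL).
  rewrite -[p s]/(sg s * v2 s) -[q s]/(sg s * v1 s) !exprMn -mulrDr sg2.
  suff -> : v2 s ^+ 2 + v1 s ^+ 2 = dot (X2 s) (X2 s) by rewrite mulVf// gt_eqF.
  rewrite {1}(X2_decomp sL) -scaleNr dot_comb /v1 /v2 !(dotC (X2 s)); ring.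
have cw s : 0 < s < L -> {for s, continuous (fun s => p s * dq s - q s * dp s)}.
  move=> sL; rewrite (funext wE); apply: cvg_angle_derivative.
  - exact: is_derive_continuous (derX2 sL).
  - exact: contX3.
  - exact: X2_neq0.
  - exact: cvg_id.
have [theta [dth pqth cth]] := circle_lift L0 derp derq pq1 cw.
have dth' s : 0 < s < L -> is_derive s 1 theta (angle_speed s) by move=> /dth; rewrite wE.
have sgK s : 0 < s < L -> enorm (X2 s) * sg s = 1.
  by move=> /X2_neq0; exact: divff.
rewrite (funext wE) in cth; exists theta; split.
- exact: dth'.
- move=> s sL; have [<- <-] := pqth s sL.
  rewrite -[p s]/(sg s * v2 s) -[q s]/(sg s * v1 s) !mulrA sgK// !mul1r.
  by split.
- move=> s sL.
  have nE r : 0 < r < L -> sg r *: X2 r = p r *: D1 r - q r *: D2 r.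
    by move=> rL; rewrite (X2_decomp rL) scalerBr !scalerA.
  have bE : \forall r \near s, q r *: D1 r + p r *: D2 r = cross (T r) (sg r *: X2 r).
    have := itv_oo_nbhs sL; apply: filterS => r rL.
    by rewrite nE// cross_frame//; [exact: orthoTD|exact: crossTD].
  have dpE : dp s = - sin (theta s) * angle_speed s.
    apply: is_derive_inj (derp s sL) (is_derive1_comp (is_derive_cos _) (dth' s sL)).
    by have := itv_oo_nbhs sL; apply: filterS => r /pqth[].
  have dqE : dq s = cos (theta s) * angle_speed s.
    apply: is_derive_inj (derq s sL) (is_derive1_comp (is_derive_sin _) (dth' s sL)).
    by have := itv_oo_nbhs sL; apply: filterS => r /pqth[].
  apply: (near_eq_is_derive bE).
  (* The tangential terms - q v2 t and p v1 t cancel, since q v2 = p v1; what remains is theta' (p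
     d1 - q d2). *)
  have := is_derive_comb (derq s sL) (derp s sL) (derD1 sL) (derD2 sL).
  move/is_derive_eq; apply.
  have [pE qE] := pqth s sL; rewrite -/(sg s) nE// dpE dqE -pE -qE.
  rewrite -[p s]/(sg s * v2 s) -[q s]/(sg s * v1 s).
  by apply/rowP => i; rewrite !mxE; ring.
- exact: cth.
Qed.

End frenet_angle.

(** * The weak frame system: integral form, orthonormality, orientation *)

Section frame.
Context {R : realType}.
Notation mu := (@lebesgue_measure R).
Implicit Types (L s : R).

Lemma primitiveD (F f G g : R -> R) : primitive F f -> primitive G g ->
  primitive (fun s => F s + G s) (fun s => f s + g s).
Proof.
move=> [intf Ff] [intg Gg]; split=> [|a b ab]; first exact: integrable_EFinD.
rewrite RintegralD//; last 2 first.
- exact: (integrableS _ _ _ intf).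
- exact: (integrableS _ _ _ intg).
by rewrite -Ff// -Gg//; ring.
Qed.

Lemma primitive0_cst (F f : R -> R) : primitive F f -> f =1 (fun=> 0) ->
  forall s, F s = F 0.
Proof.
move=> [_ Ff] f0; have int0 (a b : R) : \int[mu]_(x in `]a, b]) f x = 0.
  by under eq_Rintegral do rewrite f0; rewrite Rintegral_cst// mul0r.
move=> s; apply/eqP; rewrite -subr_eq0; apply/eqP.
have [s0|/ltW s0] := leP 0 s; first by rewrite Ff.
by apply: oppr_inj; rewrite opprB oppr0 Ff.
Qed.

Lemma weak_derivativev_primitive L (f g : R -> 'rV[R]_3) : 0 < L ->
  {within `[0, L], continuous f} ->
  (forall i, mu.-integrable `]0, L[ (EFin \o (fun s => g s 0 i))) ->
  weak_derivativev L f g ->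
  exists F : R -> 'rV[R]_3,
    [/\ forall i, primitive (fun s => F s 0 i) ((fun s => g s 0 i) \_ `]0, L[),
        F 0 = f 0 & forall s, 0 < s < L -> F s = f s].
Proof.
move=> L0 cf intg fg.
have cfi i : {within `[0, L], continuous (fun s => f s 0 i)}.
  by move=> s; apply: cvg_coord; exact: cf.
have /choice[F FP] := fun i => weak_derivative_primitive L0 (cfi i) (intg i) (fg i).
exists (fun s => \row_i F i s); split.
- by move=> i; under eq_fun do rewrite mxE; case: (FP i).
- by apply/rowP => i; rewrite mxE; case: (FP i).
- by move=> s sL; apply/rowP => i; rewrite mxE; case: (FP i) => _ _; exact.
Qed.

(** With coefficients extended by zero the system holds in integral form on the whole line, the new
    frame being constant on each side of [0, L]. *)
Lemma frame_solution_primitive L u1 u2 t0 d10 d20 (t d1 d2 : R -> 'rV[R]_3)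
    (w1 := u1 \_ `]0, L[) (w2 := u2 \_ `]0, L[) : 0 < L ->
  L2 L u1 -> L2 L u2 -> frame_solution L u1 u2 t0 d10 d20 t d1 d2 ->
  exists T D1 D2 : R -> 'rV[R]_3,
    [/\ forall i, primitive (fun s => T s 0 i) (fun s => w2 s * D1 s 0 i - w1 s * D2 s 0 i),
        forall i, primitive (fun s => D1 s 0 i) (fun s => - (w2 s * T s 0 i)),
        forall i, primitive (fun s => D2 s 0 i) (fun s => w1 s * T s 0 i),
        [/\ T 0 = t0, D1 0 = d10 & D2 0 = d20] &
        forall s, 0 < s < L -> T s = t s].
Proof.
move=> L0 u1L u2L [[[ct _] [cd1 _] [cd2 _]] wt wd1 wd2 [t00 d100 d200]].
have mI : measurable (`]0, L[ : set (measurableTypeR R)) by [].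
have coord (f : R -> 'rV[R]_3) : {within `[0, L], continuous f} ->
    forall i, {within `[0, L], continuous (fun s => f s 0 i)}.
  by move=> cf i s; apply: cvg_coord; exact: cf.
have int u (f : R -> 'rV[R]_3) i : L2 L u -> {within `[0, L], continuous f} ->
    mu.-integrable `]0, L[ (EFin \o (fun s => u s * f s 0 i)).
  by move=> uL /coord cf; exact: integrable_mul_within_continuous.
have [|T [pT T0 TE]] := weak_derivativev_primitive L0 ct _ wt.
  move=> i; rewrite [X in EFin \o X](_ : _ =
    (fun s => u2 s * d1 s 0 i - u1 s * d2 s 0 i)).
    by apply: integrable_EFinB => //; exact: int.
  by apply/funext => s; rewrite !mxE.
have [|D1 [pD1 D10 D1E]] := weak_derivativev_primitive L0 cd1 _ wd1.
  move=> i; rewrite [X in EFin \o X](_ : _ = (fun s => -1 * (u2 s * t s 0 i))).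
    by apply: integrable_EFinZl => //; exact: int.
  by apply/funext => s; rewrite !mxE mulN1r.
have [|D2 [pD2 D20 D2E]] := weak_derivativev_primitive L0 cd2 _ wd2.
  move=> i; rewrite [X in EFin \o X](_ : _ = (fun s => u1 s * t s 0 i)).
    exact: int.
  by apply/funext => s; rewrite !mxE.
exists T, D1, D2; split => //; last by rewrite T0 D10 D20.
(* Outside ]0, L[ the densities vanish with the coefficients; inside, the primitives agree with the
   solution, so the system closes on [T], [D1], [D2]. *)
- move=> i; move: (pT i); congr primitive.
  apply/funext => s; rewrite /w1 /w2 !patchE /=; case: ifPn; rewrite ?mul0r ?subr0//.
  by rewrite mem_setE in_itv/= => sL; rewrite !mxE D1E ?D2E.
- move=> i; move: (pD1 i); congr primitive.
  apply/funext => s; rewrite /w1 /w2 !patchE /=; case: ifPn; rewrite ?mul0r ?oppr0//.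
  by rewrite mem_setE in_itv/= => sL; rewrite !mxE TE.
- move=> i; move: (pD2 i); congr primitive.
  apply/funext => s; rewrite /w1 /w2 !patchE /=; case: ifPn; rewrite ?mul0r ?oppr0//.
  by rewrite mem_setE in_itv/= => sL; rewrite !mxE TE.
Qed.

Section orthonormality.
Variables (w1 w2 : R -> R) (T D1 D2 : R -> 'rV[R]_3).
Hypothesis pT : forall i,
  primitive (fun s => T s 0 i) (fun s => w2 s * D1 s 0 i - w1 s * D2 s 0 i).
Hypothesis pD1 : forall i, primitive (fun s => D1 s 0 i) (fun s => - (w2 s * T s 0 i)).
Hypothesis pD2 : forall i, primitive (fun s => D2 s 0 i) (fun s => w1 s * T s 0 i).

(** By antisymmetry of the system, each entry t_i t_j + d1_i d1_j + d2_i d2_j has density zero and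
    keeps its initial value. *)
Lemma frame_orthonormal : orthonormal3 (T 0) (D1 0) (D2 0) ->
  forall s, orthonormal3 (T s) (D1 s) (D2 s).
Proof.
move=> /orthonormal3P O s; apply/orthonormal3P => i j; rewrite -O.
have := primitiveD (primitiveD (primitiveM (pT i) (pT j)) (primitiveM (pD1 i) (pD1 j)))
  (primitiveM (pD2 i) (pD2 j)).
by move=> /primitive0_cst; apply => r /=; ring.
Qed.

(** The determinant is continuous, has square 1 and starts at 1; the value -1 would force a zero in
    between. *)
Lemma frame_positive : orthonormal3 (T 0) (D1 0) (D2 0) ->
  cross (T 0) (D1 0) = D2 0 -> forall s, 0 <= s -> cross (T s) (D1 s) = D2 s.
Proof.
move=> O cross0 s s0.
pose det r := dot (cross (T r) (D1 r)) (D2 r).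
have det1 r : det r ^+ 2 = 1 by have [] := orthonormal3_cross (frame_orthonormal O r).
have cdet : continuous det.
  move=> r; have cT i := @primitive_continuous _ _ _ (pT i) r.
  have cD1 i := @primitive_continuous _ _ _ (pD1 i) r.
  have cD2 i := @primitive_continuous _ _ _ (pD2 i) r.
  apply: cvg_dot => [i|//].
  under eq_fun do rewrite mxE; rewrite mxE.
  by apply: cvgB; apply: cvgM; first [exact: cT|exact: cD1].
have det0 : det 0 = 1 by rewrite /det cross0; have [[]] := O.
suff dets : det s = 1.
  have [-> _] := orthonormal3_cross (frame_orthonormal O s).
  by rewrite -/(det s) dets scale1r.
have /eqP := det1 s; rewrite sqrf_eq1 => /orP[/eqP//|/eqP dets].
have [||c _ detc] := @IVT R det 0 s 0 s0.
- exact: continuous_subspaceT.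
- by rewrite det0 dets ge_min le_max !lerN10 ?ler01 orbT.
- by have := det1 c; rewrite detc expr0n => /eqP; rewrite eq_sym oner_eq0.
Qed.

End orthonormality.

Lemma curve_is_derive L t0 (t : R -> 'rV[R]_3) s :
  {within `[0, L], continuous t} -> 0 < s < L -> is_derive s 1 (curve t0 t) (t s).
Proof.
move=> ct /andP[s0 sL]; apply/is_derive_rowP => i.
have cti : {within `[0, L], continuous (fun r => t r 0 i)}.
  by move=> r; apply: cvg_coord; exact: ct.
pose I r := \int[mu]_(x in `[0, r]) t x 0 i.
have dI : is_derive s 1 I (t s 0 i).
  apply/is_derive1E; apply: (continuous_FTC1_closed sL) => //.
    exact: continuous_compact_integrable (@segment_compact _ 0 L) cti.
  have /(continuous_within_itvP _ (lt_trans s0 sL))[+ _ _] := cti.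
  by apply; rewrite in_itv/= s0.
have -> : (fun r => curve t0 t r 0 i) = cst (t0 0 i) + I.
  by apply/funext => r; rewrite /curve !mxE.
by rewrite -[t s 0 i]add0r; exact: is_deriveD.
Qed.

End frame.

(** The relations with [u1] and [u2] hold almost everywhere, these being L^2 classes. A negatively
    oriented frame would turn theta' into minus the torsion, hence [positive0]. At the endpoints
    theta' has limits once x'' and x''' do and those of x'' are nonzero. *)
Theorem lemma2p2 (R : realType) (L : R) (t0 d10 d20 : 'rV[R]_3)
    (u1 u2 : R -> R) (t d1 d2 x : R -> 'rV[R]_3)
    (L_gt0 : 0 < L)
    (orthonormal0 : orthonormal3 t0 d10 d20)
    (positive0 : cross t0 d10 = d20)
    (u1_L2 : L2 L u1) (u2_L2 : L2 L u2)
    (solution : frame_solution L u1 u2 t0 d10 d20 t d1 d2)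
    (x_curve : forall s, 0 <= s <= L -> x s = curve t0 t s)
    (x_C3 : Ck 3 `]0, L[ x)
    (x''_neq0 : forall s, 0 < s < L -> enorm (derive1n 2 x s) != 0) :
  exists theta : R -> R,
    [/\ Ck 1 `]0, L[ theta,
        (Ck_closed 3 0 L x ->
         enorm (lim (derive1n 2 x s @[s --> 0^'+])) != 0 ->
         enorm (lim (derive1n 2 x s @[s --> L^'-])) != 0 ->
         Ck_closed 1 0 L theta),
        (forall s, 0 < s < L -> derive1 theta s = torsion x s),
        {ae lebesgue_measure, forall s, 0 < s < L ->
           u1 s = curvature x s * sin (theta s) /\
           u2 s = curvature x s * cos (theta s)} &
        {ae lebesgue_measure, forall s, 0 < s < L ->
           Num.sqrt (u1 s ^+ 2 + u2 s ^+ 2) = curvature x s}].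
Proof.
have ae_filter := ae_filter_ringOfSetsType (@lebesgue_measure R).
have [T [D1 [D2 [pT pD1 pD2 [T0 D10 D20] TE]]]] :=
  frame_solution_primitive L_gt0 u1_L2 u2_L2 solution.
have ortho0 : orthonormal3 (T 0) (D1 0) (D2 0) by rewrite T0 D10 D20.
have ortho := frame_orthonormal pT pD1 pD2 ortho0.
have pos s : 0 < s < L -> cross (T s) (D1 s) = D2 s.
  move=> /andP[s0 _]; apply: (frame_positive pT pD1 pD2 ortho0) (ltW s0).
  by rewrite T0 D10 D20.
have ct : {within `[0, L], continuous t} by case: solution => -[[]].
have dx s : 0 < s < L -> derive1 x s = T s.
  move=> sL; rewrite derive1E TE//.
  suff [] : is_derive s 1 x (t s) by [].
  apply: near_eq_is_derive (curve_is_derive t0 ct sL).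
  have := itv_oo_nbhs sL; apply: filterS => r /andP[r0 rL].
  by rewrite x_curve// !ltW.
pose X2 := derive1n 2 x; pose X3 := derive1n 3 x.
have xC3 s : 0 < s < L ->
    (forall j, (j < 3)%N -> derivable (derive1n j x) s 1) /\ {for s, continuous X3}.
  by move=> sL; apply: x_C3; rewrite /= in_itv.
have dT s : 0 < s < L -> is_derive s 1 T (X2 s).
  move=> sL; have [/(_ 1%N isT) dx1 _] := xC3 s sL.
  apply: (@near_eq_is_derive _ _ _ (derive1 x)).
    by have := itv_oo_nbhs sL; apply: filterS => r /dx.
  by apply/is_derive1E; split; first exact: dx1.
have dX2 s : 0 < s < L -> is_derive s 1 X2 (X3 s).
  move=> sL; have [/(_ 2%N isT) dx2 _] := xC3 s sL.
  by apply/is_derive1E; split; first exact: dx2.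
have cX3 s : 0 < s < L -> {for s, continuous X3} by move=> /xC3[].
pose v1 s := - dot (X2 s) (D2 s); pose v2 s := dot (X2 s) (D1 s).
(* At almost every point the density of [T] is its classical derivative [X2]; pairing with [D1] and
   [D2] isolates the coefficients. *)
have ae_u : {ae lebesgue_measure, forall s, 0 < s < L -> u1 s = v1 s /\ u2 s = v2 s}.
  have aeT i := primitive_ae_is_derive (pT i).
  have := filter_forall ae_filter aeT.
  apply: filterS.
  move=> s /= dTs sL.
  have X2E : X2 s = u2 s *: D1 s + - u1 s *: D2 s.
    apply/rowP => i; have /is_derive_rowP/(_ i) dTi := dT s sL.
    have [[_ <-] [_ ->]] := (dTi, dTs i).
    by rewrite !patchE mem_setE in_itv/= sL !mxE mulNr.
  have [[_ D11 D22] [_ _ D12]] := ortho s.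
  by rewrite /v1 /v2 X2E !dot_comb (dotC (D2 s)) D11 D22 D12; split; ring.
have cT i := primitive_continuous (pT i).
have cD1 i := primitive_continuous (pD1 i).
have cD2 i := primitive_continuous (pD2 i).
have cX2 s : 0 < s < L -> {for s, continuous X2}.
  by move=> /dX2; exact: is_derive_continuous.
have cv1 s : 0 < s < L -> {for s, continuous v1}.
  move=> /cX2/cvg_coord cX2s; apply: cvgN; apply: cvg_dot => //.
  by move=> i; exact: cD2.
have cv2 s : 0 < s < L -> {for s, continuous v2}.
  by move=> /cX2/cvg_coord cX2s; apply: cvg_dot => // i; exact: cD1.
(* The density of [D1] agrees almost everywhere with a continuous function, so the equation becomes
   classical; likewise for [D2] below. *)
have dD1 s : 0 < s < L -> is_derive s 1 D1 (- (v2 s *: T s)).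
  move=> sL; apply/is_derive_rowP => i.
  apply: (primitive_is_derive (v := fun r => (- (v2 r *: T r)) 0 i) (pD1 i)) sL.
    apply: filterS ae_u => r ur rL; rewrite !mxE patchE mem_setE in_itv/= rL.
    by have [_ ->] := ur rL.
  have -> : (fun r => (- (v2 r *: T r)) 0 i) = fun r => - (v2 r * T r 0 i).
    by apply/funext => r; rewrite !mxE.
  move=> r rL; apply: cvgN; apply: cvgM; [exact: cv2|exact: cT].
have dD2 s : 0 < s < L -> is_derive s 1 D2 (v1 s *: T s).
  move=> sL; apply/is_derive_rowP => i.
  apply: (primitive_is_derive (v := fun r => (v1 r *: T r) 0 i) (pD2 i)) sL.
    apply: filterS ae_u => r ur rL; rewrite !mxE patchE mem_setE in_itv/= rL.
    by have [-> _] := ur rL.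
  have -> : (fun r => (v1 r *: T r) 0 i) = fun r => v1 r * T r 0 i.
    by apply/funext => r; rewrite !mxE.
  by move=> r rL; apply: cvgM; [exact: cv1|exact: cT].
have orthoL s : 0 < s < L -> orthonormal3 (T s) (D1 s) (D2 s) by move=> _; exact: ortho.
have X2_neq0 s : 0 < s < L -> enorm (X2 s) != 0 by exact: x''_neq0.
have cvg_w := cvg_angle_derivative cD1 cD2.
have [theta [dth uth bth cth]] :=
  frenet_angle L_gt0 dT dX2 cX3 dD1 dD2 cD1 cD2 orthoL pos X2_neq0.
pose w := angle_speed D1 D2 X2 X3.
have thE s : 0 < s < L -> derive1 theta s = w s 
  by move=> sL; have /is_derive1E[_ e] := dth s sL; exact: e.
have ck1 : Ck 1 `]0, L[ theta.
  move=> s; rewrite /= in_itv/= => sL; split=> [[|//] _|].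
    by have [d _] := dth s sL; exact: d.
  have ws : w r @[r --> s] --> w s.
    exact: (cvg_w _ _ _ _ _ _ s (cX2 s sL) (cX3 s sL) (X2_neq0 s sL) cvg_id).
  suff : derive1 theta r @[r --> s] --> derive1 theta s by [].
  rewrite (thE s sL).
  apply: (cvg_trans _ ws); apply: near_eq_cvg.
  by have := itv_oo_nbhs sL; apply: filterS => r /thE.
exists theta; split => //.
- move=> [_ _ lim3] n0 nL.
  have [c20 c2L] := lim3 2%N isT; have [c30 c3L] := lim3 3%N isT.
  have [l0 w0] : exists l0 : R, w r @[r --> 0^'+] --> l0.
    by eexists; exact: (cvg_w _ _ _ _ _ _ 0 c20 c30 n0 (cvg_within _)).
  have [lL wL] : exists lL : R, w r @[r --> L^'-] --> lL.
    by eexists; exact: (cvg_w _ _ _ _ _ _ L c2L c3L nL (cvg_within _)).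
  split=> //; first by apply: cth; apply/cvg_ex; [exists l0|exists lL].
  move=> [|[|//]] // _; split; apply/cvg_ex; [exists l0|exists lL].
    apply: cvg_trans w0; apply: near_eq_cvg; near=> r; apply/esym/thE/andP; split;
      near: r; [exact: nbhs_right_gt|exact: nbhs_right_lt].
  apply: cvg_trans wL; apply: near_eq_cvg; near=> r; apply/esym/thE/andP; split;
    near: r; [exact: nbhs_left_gt|exact: nbhs_left_lt].
- move=> s sL; rewrite thE//.
  have bE : \forall r \near s, cross (T r) ((enorm (X2 r))^-1 *: X2 r) = binormal x r.
    have := itv_oo_nbhs sL; apply: filterS => r rL.
    by rewrite /binormal /tangent dx.
  have /is_derive1E[_ dbE] := near_eq_is_derive bE (bth s sL).
  have nE : normal x s = (enorm (X2 s))^-1 *: X2 s by [].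
  have X2s : X2 s != 0.
    apply: contraNneq (X2_neq0 s sL) => ->.
    by rewrite /enorm dotE !mxE !mul0r !addr0 sqrtr0.
  (* [torsion] is a choice among the solutions tau of b' = tau n, so the angular speed must be the
     only one; this holds because n is nonzero. *)
  apply/esym/xget_unique => [|y] /=; first by rewrite dbE nE.
  rewrite dbE nE => /eqP; rewrite -subr_eq0 -scalerBl !scaler_eq0 subr_eq0 invr_eq0.
  by rewrite (negbTE X2s) (negbTE (X2_neq0 s sL)) !orbF => /eqP.
- apply: filterS ae_u => s us sL; have [-> ->] := us sL; exact: uth.
- apply: filterS ae_u => s us sL; have [-> ->] := us sL.
  rewrite /v1 /v2; have [-> ->] := uth s sL.
  rewrite !exprMn -mulrDr addrC cos2Dsin2 mulr1 sqrtr_sqr.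
  by rewrite ger0_norm// sqrtr_ge0.
Unshelve. all: by end_near. Qed.
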